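(* Assume (A1)–(A4) and $P^\star\in\Pi_{K^\star}\setminus\Pi_{K^\star-1}$ with $K^\star<\infty$. Suppose $\varphi(u-l)\in L^1(P^\star)$ and that the penalty satisfies, for every $K\ge 1$, $$\liminf_{n\to\infty}\frac{\mathrm{pen}(n,K+1)}{\mathrm{pen}(n,K)}>1\quad\text{and}\quad \limsup_{n\to\infty}\frac{(n\log\log n)^{1/2}}{\mathrm{pen}(n,K)}=0 .$$ (a) If, for every $K\ge1$, $P^\star\notin\Pi_K$ implies $H(P^\star|\Pi_{K+1})<H(P^\star|\Pi_K)$, and if $\mathcal G^a_{K^\star+1}$ is $P^\star$-Donsker, then $P^\star$-a.s. $\widehat K_n^L=K^\star$ for all $n$ large enough. (b) If $K^\star\le K_{\max}$ and $\mathcal G^a_{K_{\max}}$ is $P^\star$-Donsker, then $P^\star$-a.s. $\widehat K_n^G=K^\star$ for all $n$ large enough.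
   Context: Setting: $(\mathcal Z,\mathcal F)$ is a Polish space with its Borel $\sigma$-field and $\mu$ a $\sigma$-finite measure on it. $Z_1,Z_2,\dots$ are i.i.d. $\mathcal Z$-valued random variables with common law $P^\star\ll\mu$, density $p^\star$, $\ell^\star=\log p^\star$; $P^\star$ also denotes the law of the whole sequence. $\{(\Theta_K,d)\}_{K\ge1}$ is an increasing (nested) sequence of metric spaces, $\Theta_\infty=\bigcup_K\Theta_K$; for $\theta\in\Theta_\infty$, $P_\theta$ is a probability measure with density $p_\theta$ w.r.t. $\mu$ and $\ell_\theta=\log p_\theta$. $\Pi_K=\{P_\theta:\theta\in\Theta_K\}$, $\Pi_0=\emptyset$, $\Pi_\infty=\bigcup_K\Pi_K$. The order of $P^\star$ is $K^\star=\min\{K:P^\star\in\Pi_K\}$ ($=\infty$ if $P^\star\notin\Pi_\infty$). $\mathbb P_n=n^{-1}\sum_{i=1}^n\delta_{Z_i}$; $\lambda f=\int f\,d\lambda$. $H(P|Q)=\int\log(dP/dQ)\,dP$ if $P\ll Q$ and $+\infty$ otherwise; $H(P|\Pi)=\inf_{Q\in\Pi}H(P|Q)$, $H(\Pi|Q)=\inf_{P\in\Pi}H(P|Q)$. Given a penalty $\mathrm{pen}(n,K)>0$, $\mathrm{crit}(n,K)=\sup_{\theta\in\Theta_K}\sum_{i=1}^n\ell_\theta(Z_i)-\mathrm{pen}(n,K)$, $\widehat K_n^L=\inf\{K\ge1:\mathrm{crit}(n,K)\ge\mathrm{crit}(n,K+1)\}$, and $\widehat K_n^G$ is the smallest maximizer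 of $K\mapsto\mathrm{crit}(n,K)$ (the maximization being over $1\le K\le K_{\max}$ when a known bound $K_{\max}\ge K^\star$ is assumed). All suprema are assumed measurable. Standing assumptions: (A1) each $(\Theta_K,d)$ is compact and each $\Pi_K$ is compact for the weak topology; (A2) for each $z$ and $K$, $\theta\mapsto\ell_\theta(z)$ is continuous on $\Theta_K$; (A3) there are $l,u:\mathcal Z\to\mathbb R$ with $u-l\in L^1(P^\star)$, $l\le\ell^\star\le u$ and $l\le\ell_\theta\le u$ for all $\theta\in\Theta_\infty$; (A4) for each $n$, $\mathrm{pen}(n,\cdot)$ is increasing, and for each $K$, $\mathrm{pen}(n,K)\to\infty$ and $\mathrm{pen}(n,K)=o(n)$ as $n\to\infty$. Additional notation: $\mathrm{Log}(x)=\log(\max(x,e))$, $\varphi(x)=x^2/\mathrm{Log}\,\mathrm{Log}(x)$; $\mathcal G^a_K=\{\ell_\theta-\ell^\star:\theta\in\Theta_K\}$. ''$P^\star$-Donsker'' is the standard notion for a class of functions (the empirical process indexed by the class converges weakly in $\ell^\infty$ of the class to a tight Gaussian process). *)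

(* Defs.v *)
From HB Require Import structures.
From mathcomp Require Import all_boot all_order all_algebra.
From mathcomp Require Import all_classical all_reals all_analysis.
Set Implicit Arguments. Unset Strict Implicit. Unset Printing Implicit Defensive.
Import Order.TTheory GRing.Theory Num.Theory numFieldNormedType.Exports.
Local Open Scope classical_set_scope.
Local Open Scope ring_scope.

Notation Borel Z := (g_sigma_algebraType (@open Z)).

Definition polish (R : realType) (Z : topologicalType) : Prop :=
  exists d : Z -> Z -> R,
    [/\ (forall x y, 0 <= d x y) /\ (forall x y, d x y = 0 <-> x = y),
        (forall x y, d x y = d y x) /\ (forall x y z, d x z <= d x y + d y z),
        (forall U : set Z, open U <->
           (forall x, U x -> exists2 e, 0 < e & [set y | d x y < e] `<=` U)),
        (forall u : nat -> Z,
           (forall e, 0 < e -> exists N, forall m n, (N <= m)%N -> (N <= n)%N ->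
                d (u m) (u n) < e) ->
           exists x, (fun n => d (u n) x) @ \oo --> 0)
      & exists D : set Z, countable D /\ dense D].

Section Model.
Context (R : realType) (Z : ptopologicalType).
Local Notation ZB := (Borel Z).
Context (mu : {measure set ZB -> \bar R}).

Definition is_density (q : ZB -> R) : Prop :=
  [/\ measurable_fun setT q, (forall z, 0 <= q z) &
      (\int[mu]_z (q z)%:E = 1)%E].

Definition dmeas (q : ZB -> R) (A : set ZB) : \bar R :=
  (\int[mu]_(z in A) (q z)%:E)%E.

Definition same_law (q1 q2 : ZB -> R) : Prop :=
  forall A, measurable A -> dmeas q1 A = dmeas q2 A.

Definition L1_dens (q : ZB -> R) (f : ZB -> R) : Prop :=
  mu.-integrable setT (fun z => (f z * q z)%:E).

Definition Edens (q : ZB -> R) (f : ZB -> R) : R :=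
  fine (\int[mu]_z (f z * q z)%:E)%E.

Definition bcont (f : Z -> R) : Prop :=
  continuous f /\ exists M, forall z, `|f z| <= M.

(** open sets for the weak topology (of probability measures, represented by
    their densities): generated by the maps P |-> P f, f bounded continuous *)
Definition weak_open (U : set (Z -> R)) : Prop :=
  forall q, U q -> exists (k : nat) (fs : nat -> Z -> R) (e : R),
    [/\ 0 < e, (forall i, (i < k)%N -> bcont (fs i)) &
       [set q' | forall i, (i < k)%N -> `|Edens q' (fs i) - Edens q (fs i)| < e]
         `<=` U].

Definition weak_compact (A : set (Z -> R)) : Prop :=
  forall (I : Type) (U : I -> set (Z -> R)), (forall i, weak_open (U i)) ->
    A `<=` \bigcup_i U i ->
    exists (k : nat) (j : nat -> I), A `<=` \bigcup_(m in [set m : nat | (m < k)%N]) U (j m).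

(** Kullback-Leibler divergence H(P|Q) for P, Q with densities p, q w.r.t. mu:
    P << Q iff mu(p > 0, q = 0) = 0, and then dP/dQ = p/q P-a.s. *)
Definition KL (p q : ZB -> R) : \bar R :=
  if mu [set z | (0 < p z)%R /\ (q z <= 0)%R] == 0%E
  then (\int[mu]_(z in [set z | (0 < p z)%R]) (p z * ln (p z / q z))%:E)%E
  else +oo%E.

Definition KLset (p : ZB -> R) (Pi : set (Z -> R)) : \bar R :=
  ereal_inf [set KL p q | q in Pi].

Definition cylinders : set (set (nat -> Z)) :=
  [set C | exists (k : nat) (A : nat -> set ZB), (forall i, measurable (A i)) /\
       C = [set w | forall i, (i < k)%N -> A i (w i)]].

Definition Seq := g_sigma_algebraType cylinders.

Definition iid_law (pstar : ZB -> R) (P : probability Seq R) : Prop :=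
  forall (k : nat) (A : nat -> set ZB), (forall i, measurable (A i)) ->
    P [set w : Seq | forall i, (i < k)%N -> A i (w i)] =
    (\prod_(i < k) fine (dmeas pstar (A i)))%:E.

Section Donsker.
Variable F : set (Z -> R).

Definition linf (x : (Z -> R) -> R) : Prop :=
  exists M, forall f, F f -> `|x f| <= M.

Definition supdist (x y : (Z -> R) -> R) : R :=
  sup [set `|x f - y f| | f in F].

Definition linf_open (U : set ((Z -> R) -> R)) : Prop :=
  U `<=` linf /\ forall x, U x -> exists2 e, 0 < e &
     forall y, linf y -> supdist x y < e -> U y.

Definition linf_compact (K : set ((Z -> R) -> R)) : Prop :=
  K `<=` linf /\
  forall (I : Type) (U : I -> set ((Z -> R) -> R)), (forall i, linf_open (U i)) ->
    K `<=` \bigcup_i U i ->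
    exists (k : nat) (j : nat -> I), K `<=` \bigcup_(m in [set m : nat | (m < k)%N]) U (j m).

Definition linf_bcont (h : ((Z -> R) -> R) -> R) : Prop :=
  (exists M, forall x, linf x -> `|h x| <= M) /\
  forall x, linf x -> forall e, 0 < e -> exists2 d, 0 < d &
     forall y, linf y -> supdist x y < d -> `|h y - h x| < e.

Definition outer_E (P : probability Seq R) (Y : Seq -> R) : \bar R :=
  ereal_inf [set (\int[P]_w (U w)%:E)%E | U in
     [set U : Seq -> R | [/\ measurable_fun setT U,
         P.-integrable setT (EFin \o U) & forall w, Y w <= U w]]].

Definition normal_rv d' (O : measurableType d') (P' : probability O R)
  (Y : O -> R) : Prop :=
  measurable_fun setT Y /\ exists m s : R,
    (s = 0 /\ P' (Y @^-1` [set m]) = 1%E) \/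
    (0 < s /\ forall A : set R, measurable A -> P' (Y @^-1` A) = normal_prob m s A).

Definition emp_proc (pstar : ZB -> R) (n : nat) (w : Seq) (f : Z -> R) : R :=
  Num.sqrt n%:R * (n%:R^-1 * \sum_(i < n) f (w i) - Edens pstar f).

(** F is P-Donsker (P has density pstar, P^N = Pinf): the empirical process
    converges weakly in l^infty(F) (Hoffmann-Jorgensen sense) to a tight
    Borel measurable Gaussian process. *)
Definition donsker (pstar : ZB -> R) (Pinf : probability Seq R) : Prop :=
  (forall n w, linf (emp_proc pstar n w)) /\
  exists (d' : measure_display) (O : measurableType d') (P' : probability O R)
         (G : O -> (Z -> R) -> R),
    [/\ forall o, linf (G o),
        forall U, linf_open U -> measurable (G @^-1` U),
        forall e, 0 < e -> exists K, linf_compact K /\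
                 (1 - e <= fine (P' (G @^-1` K)))%R,
        forall (k : nat) (fs : nat -> Z -> R) (a : nat -> R),
          (forall i, (i < k)%N -> F (fs i)) ->
          normal_rv P' (fun o => \sum_(i < k) a i * G o (fs i))
      & forall h, linf_bcont h ->
          (fun n => outer_E Pinf (fun w => h (emp_proc pstar n w)))
            @ \oo --> (\int[P']_o (h (G o))%:E)%E].
End Donsker.
End Model.

Definition Logm (R : realType) (x : R) : R := ln (Num.max x (expR 1)).
Definition phiLL (R : realType) (x : R) : R := x ^+ 2 / Logm (Logm x).

Definition crit (R : realType) (Z : Type) (Theta : Type) (ThetaK : nat -> set Theta)
  (p : Theta -> Z -> R) (pen : nat -> nat -> R) (w : nat -> Z) (n K : nat) : \bar R :=
  (ereal_sup [set (\sum_(i < n) ln (p th (w i)))%:E | th in ThetaK K]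
     - (pen n K)%:E)%E.

Definition is_KhatL (R : realType) (c : nat -> \bar R) (K : nat) : Prop :=
  [/\ (1 <= K)%N, (c K.+1 <= c K)%E &
      forall k, (1 <= k < K)%N -> (c k < c k.+1)%E].

Definition is_KhatG (R : realType) (c : nat -> \bar R) (Kmax K : nat) : Prop :=
  [/\ (1 <= K <= Kmax)%N, (forall k, (1 <= k <= Kmax)%N -> (c k <= c K)%E) &
      forall k, (1 <= k < K)%N -> (c k < c K)%E].

(* Main.v *)
Require Import Defs.
From HB Require Import structures.
From mathcomp Require Import all_boot all_order all_algebra.
From mathcomp Require Import all_classical all_reals all_analysis.
From mathcomp Require Import measurable_realfun.
From mathcomp Require Import ring lra zify.
Import Order.TTheory GRing.Theory Num.Theory numFieldNormedType.Exports.
Local Open Scope classical_set_scope.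
Local Open Scope ring_scope.

(* Everything follows from a bounded law of the iterated logarithm: almost surely, uniformly over
   the Donsker class of log-likelihood ratios, the centred sums are O(sqrt(n log log n)).

   Write D(a, b) for the supremum norm of the centred sum over the indices a <= i < b; the class is
   replaced by a countable dense subfamily, so that D is measurable. Weak convergence makes
   D(0, n) / sqrt n tight, hence (Ottaviani) max_{k <= m} D(0, k) <= t sqrt m with probability
   close to 1, for some fixed t and all m. Let n = m L with L of the order of log log n. Greedily
   restart the process each time it leaves the ball of radius t sqrt m: up to probability
   4^-L, this takes at most 4 L steps before time n. By the triangle inequality D(0, n) is then at
   most 4 L t sqrt m + (sum of the 4 L largest norms of single terms), and L sqrt m = sqrt(n L).
   The sum of the largest terms is O(sqrt(n L)) as well: tightness gives the weak second moment
   bound P(norm > y) = O(y^-2), which controls the j-th largest term for j large, and the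
   integrability of phi(u - l) makes the remaining probabilities summable along dyadic blocks.
   Borel-Cantelli concludes.

   Overfitting: mean log-likelihood ratios are nonpositive, so enlarging the model gains at most
   O(sqrt(n log log n)), which the penalty difference dominates. Underfitting: by the same bound
   the normalized criteria converge uniformly, and the limits are separated, in (a) by hypothesis
   and in (b) by compactness and the strict Gibbs inequality. *)

Set Implicit Arguments. Unset Strict Implicit. Unset Printing Implicit Defensive.

(** * Independence of past and future coordinates *)

Section Cylinders.
Context {Z : ptopologicalType}.
Local Notation ZB := (Borel Z).

Definition cylinder (k : nat) (A : nat -> set ZB) : set (Seq Z) :=
  [set w | forall i, (i < k)%N -> A i (w i)].

Definition seq_shift (k : nat) (w : Seq Z) : Seq Z := fun i => w (k + i)%N.

Definition seq_trunc (k : nat) (w : Seq Z) : Seq Z :=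
  fun i => if (i < k)%N then w i else point.

Definition dep (k : nat) (A : set (Seq Z)) : Prop :=
  forall w w' : Seq Z, (forall i, (i < k)%N -> w i = w' i) -> A w -> A w'.

Lemma seq_shift_add (a b : nat) (w : Seq Z) : seq_shift a (seq_shift b w) = seq_shift (b + a)%N w.
Proof. by apply/funext => i; rewrite /seq_shift addnA. Qed.

Lemma dep_trunc k A : dep k A -> seq_trunc k @^-1` A = A.
Proof.
move=> dA; apply/seteqP; split => w /=; apply: dA => i ik; by rewrite /seq_trunc ik.
Qed.

Lemma measurable_cylinder k A : (forall i, measurable (A i)) ->
  measurable (cylinder k A).
Proof. by move=> mA; apply: sub_sigma_algebra; exists k, A. Qed.

Lemma measurable_coord i : measurable_fun [set: Seq Z] (fun w : Seq Z => w i : ZB).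
Proof.
move=> _ B mB; rewrite setTI.
have -> : (fun w : Seq Z => w i : ZB) @^-1` B =
   cylinder i.+1 (fun j => if j == i then B else setT).
  apply/seteqP; split => w /= => [Bw j _|/(_ i (ltnSn i))]; last by rewrite eqxx.
  by case: eqP => // ->.
by apply: measurable_cylinder => j; case: ifP.
Qed.

Lemma measurable_to_Seq d (T : measurableType d) (F : T -> Seq Z) :
  (forall i, measurable_fun [set: T] (fun t => F t i : ZB)) ->
  measurable_fun [set: T] F.
Proof.
move=> mF; apply: (@measurability _ _ T (Seq Z) _ _ (@cylinders Z)) => //.
move=> _ [_ [k [A [mA ->]]] <-]; rewrite setTI.
have -> : F @^-1` [set w | forall i, (i < k)%N -> A i (w i)] =
  \bigcap_(i in [set i : nat | (i < k)%N]) ((fun t => F t i : ZB) @^-1` A i) by [].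
apply: bigcap_measurableType => i _.
by rewrite -[X in measurable X]setTI; exact: mF.
Qed.

Lemma measurable_shift k : measurable_fun [set: Seq Z] (seq_shift k).
Proof. by apply: measurable_to_Seq => i; exact: measurable_coord. Qed.

Lemma measurable_trunc k : measurable_fun [set: Seq Z] (seq_trunc k).
Proof.
apply: measurable_to_Seq => i; rewrite /seq_trunc; case: (i < k)%N.
  exact: measurable_coord.
exact: measurable_cst.
Qed.

Lemma measurable_preshift k A : measurable A -> measurable (seq_shift k @^-1` A).
Proof. by move=> mA; rewrite -[_ @^-1` _]setTI; exact: measurable_shift. Qed.

Lemma setI_closed_cylinders : setI_closed (@cylinders Z).
Proof.
move=> _ _ [k [A [mA ->]]] [k' [A' [mA' ->]]].
exists (maxn k k'), (fun i => (if (i < k)%N then A i else setT) `&`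
                      (if (i < k')%N then A' i else setT)); split.
  by move=> i; apply: measurableI; case: ifP.
apply/seteqP; split => w /=.
  by move=> [h h'] i _; split; case: ifP => // ?; [exact: h|exact: h'].
move=> h; split => i ik; have := h i; rewrite leq_max ik ?orbT => /(_ isT) []; by [].
Qed.

Context {R : realType} (P : probability (Seq Z) R) (q : set ZB -> R).
Hypothesis Pcyl : forall (k : nat) (A : nat -> set ZB), (forall i, measurable (A i)) ->
  P (cylinder k A) = (\prod_(i < k) q (A i))%:E.

Local Lemma cylinders_setT : @cylinders Z setT.
Proof.
exists 0%N, (fun=> setT); split => //.
by apply/seteqP; split.
Qed.

Local Lemma pushforwardP (m : {measure set (Seq Z) -> \bar R}) (f : Seq Z -> Seq Z) :
  measurable_fun setT f -> exists m' : {measure set (Seq Z) -> \bar R}, forall A, m' A = m (f @^-1` A).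
Proof.
move=> mf; pose pf : {measure set (Seq Z) -> \bar R} := pushforward m f.
by exists (pf mf) => A.
Qed.

Local Lemma measure_eq_cylinders (m1 m2 : {measure set (Seq Z) -> \bar R}) :
  (m1 setT < +oo)%E ->
  (forall k A, (forall i, measurable (A i)) -> m1 (cylinder k A) = m2 (cylinder k A)) ->
  forall B, measurable B -> m1 B = m2 B.
Proof.
move=> fin eqc B mB.
apply: (@measure_unique _ R (Seq Z) (@cylinders Z) (fun=> setT)) => //.
- exact: setI_closed_cylinders.
- by move=> _; exact: cylinders_setT.
- by rewrite bigcup_const //; exists 0%N.
- by move=> _ [k [A [mA ->]]]; exact: eqc.
Qed.

Local Lemma indep_cylinder k C (B : set (Seq Z)) :
  (forall i, measurable (C i)) -> measurable B ->
  P (cylinder k C `&` seq_shift k @^-1` B) = (P (cylinder k C) * P B)%E.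
Proof.
move=> mC.
have mcC := measurable_cylinder k mC.
pose r : {nonneg R} := NngNum (fine_ge0 (measure_ge0 P (cylinder k C))).
have [m1 m1P] := pushforwardP (mrestr P mcC) (@measurable_shift k).
pose m2 : {measure set (Seq Z) -> \bar R} := mscale r P.
have m1E A : m1 A = P (cylinder k C `&` seq_shift k @^-1` A).
  by rewrite m1P setIC.
have m2E A : m2 A = (P (cylinder k C) * P A)%E.
  by rewrite /m2 /= /mscale /= fineK // fin_num_measure.
rewrite -m1E -m2E; move: B.
apply: measure_eq_cylinders => [|j A mA].
  by rewrite m1E preimage_setT setIT (le_lt_trans (probability_le1 P mcC)) ?ltry.
rewrite m1E m2E.
have -> : cylinder k C `&` seq_shift k @^-1` cylinder j A =
  cylinder (k + j) (fun i => if (i < k)%N then C i else A (i - k)%N).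
  apply/seteqP; split => w /=.
    move=> [wC wA] i ikj; case: ltnP => ik; first exact: wC.
    by rewrite -[i in w i](subnKC ik); apply: wA; rewrite ltn_subLR.
  move=> h; split => i ik.
    by have := h i (ltn_addr _ ik); rewrite ik.
  have := h (k + i)%N; rewrite ltn_add2l => /(_ ik).
  by rewrite ltnNge leq_addr /= addKn.
rewrite !Pcyl //; last by move=> i; case: ifP.
rewrite -EFinM big_split_ord /=; congr (_ * _)%:E; apply: eq_bigr => i _ /=.
  by rewrite ltn_ord.
by rewrite ltnNge leq_addr /= addKn.
Qed.

Local Lemma indep_trunc k (A B : set (Seq Z)) : measurable A -> measurable B ->
  P (seq_trunc k @^-1` A `&` seq_shift k @^-1` B) = (P (seq_trunc k @^-1` A) * P B)%E.
Proof.
move=> mA mB; move: A mA.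
have mcB := measurable_preshift k mB.
pose r : {nonneg R} := NngNum (fine_ge0 (measure_ge0 P B)).
have [m1 m1P] := pushforwardP (mrestr P mcB) (@measurable_trunc k).
have [m3 m3P] := pushforwardP P (@measurable_trunc k).
pose m2 : {measure set (Seq Z) -> \bar R} := mscale r m3.
have m2E A : m2 A = (P (seq_trunc k @^-1` A) * P B)%E.
  by rewrite /m2 /= /mscale /= m3P fineK ?fin_num_measure // muleC.
have m1E A : m1 A = P (seq_trunc k @^-1` A `&` seq_shift k @^-1` B) by exact: m1P.
suff eqm A : measurable A -> m1 A = m2 A.
  by move=> A mA; rewrite -m2E -eqm.
move: A.
apply: measure_eq_cylinders => [|j A mA].
  by rewrite m1E preimage_setT setTI (le_lt_trans (probability_le1 P mcB)) ?ltry.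
rewrite m2E m1E.
have [h|h] := pselect (forall i, (k <= i < j)%N -> A i point); last first.
  have -> : seq_trunc k @^-1` cylinder j A = set0.
    apply/seteqP; split => // w /= wA; apply: h => i /andP[ki ij].
    by have := wA i ij; rewrite /seq_trunc ltnNge ki.
  by rewrite set0I !measure0 mul0e.
have -> : seq_trunc k @^-1` cylinder j A =
    cylinder k (fun i => if (i < j)%N then A i else setT).
  apply/seteqP; split => w /= wA i ik.
    by case: ifP => // ij; have := wA i ij; rewrite /seq_trunc ik.
  rewrite /seq_trunc; case: ltnP => ki; first by have := wA i ki; rewrite ik.
  by apply: h; rewrite ki.
by apply: indep_cylinder => // i; case: ifP.
Qed.

Lemma indep_shift k (A B : set (Seq Z)) : dep k A -> measurable A -> measurable B ->
  P (A `&` seq_shift k @^-1` B) = (P A * P B)%E.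
Proof. by move=> dA mA mB; rewrite -(dep_trunc dA); apply: indep_trunc. Qed.

End Cylinders.

(** * First passages and jumps of subadditive processes *)

Section RealProbability.
Context d (T : measurableType d) (R : realType) (P : probability T R).

Definition prob (A : set T) : R := fine (P A).

Lemma probE A : measurable A -> P A = (prob A)%:E.
Proof. by move=> mA; rewrite /prob fineK // fin_num_measure. Qed.

Lemma prob_ge0 A : 0 <= prob A.
Proof. by rewrite /prob fine_ge0. Qed.

Lemma prob0 : prob set0 = 0.
Proof. by rewrite /prob measure0. Qed.

Lemma probT : prob setT = 1.
Proof. by rewrite /prob probability_setT. Qed.

Lemma le_prob A B : measurable A -> measurable B -> A `<=` B -> prob A <= prob B.
Proof.
by move=> mA mB AB; rewrite -lee_fin -!probE //; apply: le_measure; rewrite ?inE.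
Qed.

Lemma prob_le1 A : measurable A -> prob A <= 1.
Proof. by move=> mA; rewrite -probT; apply: le_prob. Qed.

Lemma probU A B : measurable A -> measurable B -> A `&` B = set0 ->
  prob (A `|` B) = prob A + prob B.
Proof.
move=> mA mB AB; apply: EFin_inj; rewrite EFinD -!probE //; last exact: measurableU.
exact: measureU.
Qed.

Lemma probC A : measurable A -> prob (~` A) = 1 - prob A.
Proof.
move=> mA; have := probU mA (measurableC mA); rewrite setICr setUv probT => /(_ erefl) ->.
by rewrite addrAC subrr add0r.
Qed.

Lemma prob_le_setU A B C : measurable A -> measurable B -> measurable C ->
  A `<=` B `|` C -> prob A <= prob B + prob C.
Proof.
move=> mA mB mC ABC; have mBC : measurable (B `|` C) by exact: measurableU.
apply: (le_trans (le_prob mA mBC ABC)).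
by rewrite -lee_fin EFinD -!probE //; exact: measureU2.
Qed.

Lemma prob_le_sum n (A : nat -> set T) E :
  (forall k, measurable (A k)) -> measurable E ->
  E `<=` [set t | exists k, (k < n)%N /\ A k t] -> prob E <= \sum_(k < n) prob (A k).
Proof.
move=> mA; elim: n E => [|n IH] E mE EA.
  by rewrite big_ord0 -prob0 le_prob // => t /EA [k []].
rewrite big_ord_recr /=.
have mD : measurable (E `\` A n) by exact: measurableD.
apply: (le_trans (prob_le_setU mE mD (mA n) _)).
  by move=> t Et; have [At|nAt] := pselect (A n t); [right|left].
rewrite lerD2r; apply: IH => // t [/EA [k [kn Ak]] nAn].
exists k; split => //; rewrite ltn_neqAle -ltnS kn andbT.
by apply/eqP => kE; apply: nAn; rewrite -kE.
Qed.

Lemma sum_disjoint_prob_le n (A : nat -> set T) E :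
  (forall k, measurable (A k)) -> measurable E ->
  (forall i j, A i `&` A j !=set0 -> i = j) ->
  (forall k, (k < n)%N -> A k `<=` E) -> \sum_(k < n) prob (A k) <= prob E.
Proof.
move=> mA mE dA AE.
have tA : trivIset `I_n A by move=> i j _ _; exact: dA.
have mU : measurable (\big[setU/set0]_(k < n) A k) by exact: bigsetU_measurable.
have <- : prob (\big[setU/set0]_(k < n) A k) = \sum_(k < n) prob (A k).
  apply: EFin_inj; rewrite -probE // -sumEFin.
  rewrite measure_semi_additive_ord_I //.
  by apply: eq_bigr => i _; exact: probE.
apply: le_prob => // t; rewrite -bigcup_mkord => -[k /= kn]; exact: AE.
Qed.

End RealProbability.

Lemma measurable_fun_gt d (T : measurableType d) (R : realType) (X : T -> R) t :
  measurable_fun setT X -> measurable [set w | t < X w].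
Proof.
move=> mX; have -> : [set w | t < X w] = setT `&` X @^-1` `]t, +oo[%classic.
  by rewrite setTI; apply/seteqP; split => w; rewrite /= in_itv /= andbT.
by apply: mX => //; exact: measurable_itv.
Qed.

Section Process.
Context {Z : ptopologicalType} {R : realType} (P : probability (Seq Z) R).
Local Notation Pr := (prob P).

Hypothesis Pind : forall k (A B : set (Seq Z)), dep k A -> measurable A ->
  measurable B -> P (A `&` seq_shift k @^-1` B) = (P A * P B)%E.

Lemma prob_indep k (A B : set (Seq Z)) : dep k A -> measurable A -> measurable B ->
  Pr (A `&` seq_shift k @^-1` B) = Pr A * Pr B.
Proof.
move=> dA mA mB; apply: EFin_inj; rewrite EFinM -!probE //; first exact: Pind.
by apply: measurableI => //; exact: measurable_preshift.
Qed.

Lemma prob_shift k (B : set (Seq Z)) : measurable B -> Pr (seq_shift k @^-1` B) = Pr B.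
Proof.
by move=> mB; have := @prob_indep k setT B; rewrite setTI probT mul1r; exact.
Qed.

Variable D : nat -> Seq Z -> R.
Hypothesis D0 : forall w, D 0 w = 0.
Hypothesis mD : forall n, measurable_fun setT (D n).
Hypothesis depD : forall n (w w' : Seq Z),
  (forall i, (i < n)%N -> w i = w' i) -> D n w = D n w'.
Hypothesis Dadd : forall a b w, D (a + b) w <= D a w + D b (seq_shift a w).
Hypothesis Dl : forall a b w, D a w <= D (a + b) w + D b (seq_shift a w).
Hypothesis Dr : forall a b w, D b (seq_shift a w) <= D a w + D (a + b) w.

Lemma measurable_gt n (t : R) : measurable [set w | t < D n w].
Proof. exact: measurable_fun_gt. Qed.

Lemma measurable_le n (t : R) : measurable [set w | D n w <= t].
Proof.
have -> : [set w | D n w <= t] = ~` [set w | t < D n w].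
  by apply/seteqP; split => w /=; rewrite leNgt => /negP.
by apply: measurableC; exact: measurable_gt.
Qed.

Definition exceeds (T : R) (n : nat) : set (Seq Z) :=
  [set w | exists k, (k <= n)%N /\ T < D k w].

Definition first_passage (T : R) (k : nat) : set (Seq Z) :=
  [set w | (forall i, (i < k)%N -> D i w <= T) /\ T < D k w].

Lemma measurable_exceeds T n : measurable (exceeds T n).
Proof.
have -> : exceeds T n = \bigcup_(k in [set k | (k <= n)%N]) [set w | T < D k w].
  by apply/seteqP; split => w /= [k]; [case=> kn h; exists k|move=> kn h; exists k].
by apply: bigcup_measurable => k _; exact: measurable_gt.
Qed.

Lemma measurable_first_passage T k : measurable (first_passage T k).
Proof.
have -> : first_passage T k =
    (\bigcap_(i in [set i | (i < k)%N]) [set w | D i w <= T]) `&` [set w | T < D k w].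
  by [].
apply: measurableI; last exact: measurable_gt.
by apply: bigcap_measurableType => i _; exact: measurable_le.
Qed.

Lemma dep_first_passage T k : dep k (first_passage T k).
Proof.
move=> w w' ww' [h h']; split; last by rewrite -(depD ww').
move=> i ik; rewrite -(depD (w := w)) ?h // => j ji.
exact/ww'/(ltn_trans ji).
Qed.

Lemma first_passage_inj T i j : first_passage T i `&` first_passage T j !=set0 -> i = j.
Proof.
move=> [w [[h1 h2] [h3 h4]]]; case: (ltngtP i j) => // ij.
  by have := h3 _ ij; rewrite leNgt h2.
by have := h1 _ ij; rewrite leNgt h4.
Qed.

Lemma exceeds_first T n w : exceeds T n w ->
  exists k, (k < n.+1)%N /\ first_passage T k w.
Proof.
move=> [k [kn Tk]].
have ex : exists k, T < D k w by exists k.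
exists (ex_minn ex); case: ex_minnP => m Tm mmin; split.
  by rewrite ltnS (leq_trans _ kn) // mmin.
split => // i im; rewrite leNgt; apply/negP => /mmin; by rewrite leqNgt im.
Qed.

Lemma sum_first_passage_le T n : \sum_(k < n.+1) Pr (first_passage T k) <= Pr (exceeds T n).
Proof.
apply: sum_disjoint_prob_le.
- exact: measurable_first_passage.
- exact: measurable_exceeds.
- exact: first_passage_inj.
- by move=> k kn w [_ h]; exists k.
Qed.

Lemma exceeds_le_sum T n : Pr (exceeds T n) <= \sum_(k < n.+1) Pr (first_passage T k).
Proof.
apply: prob_le_sum; first exact: measurable_first_passage.
  exact: measurable_exceeds.
exact: exceeds_first.
Qed.

Lemma ottaviani (t : R) n : (forall k, (k <= n)%N -> Pr [set w | t < D k w] <= 1 / 2) ->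
  Pr (exceeds (2 * t) n) <= 2 * Pr [set w | t < D n w].
Proof.
move=> h; apply: (le_trans (exceeds_le_sum _ _)).
pose A k := if (k <= n)%N then
  first_passage (2 * t) k `&` seq_shift k @^-1` [set w | D (n - k) w <= t] else set0.
have mA k : measurable (A k).
  rewrite /A; case: ifP => // _; apply: measurableI.
    exact: measurable_first_passage.
  by apply: measurable_preshift; exact: measurable_le.
have le2 : \sum_(k < n.+1) Pr (A k) <= Pr [set w | t < D n w].
  apply: sum_disjoint_prob_le => //.
  - exact: measurable_gt.
  - move=> i j [w []]; rewrite /A; case: ifP => // _ [h1 _]; case: ifP => // _ [h2 _].
    by apply: (@first_passage_inj (2 * t)); exists w.
  - move=> k kn w; rewrite /A -ltnS kn => -[[_ h1] /= h2].
    have := Dl k (n - k) w; rewrite subnKC //; lra.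
rewrite -ler_pdivrMl //; apply: le_trans le2; rewrite mulr_sumr.
apply: ler_sum => -[k kn] _ /=; rewrite /A -ltnS kn.
rewrite prob_indep; last 3 first.
- exact: dep_first_passage.
- exact: measurable_first_passage.
- exact: measurable_le.
rewrite mulrC ler_wpM2l ?prob_ge0 //.
have -> : [set w | D (n - k) w <= t] = ~` [set w | t < D (n - k) w].
  by apply/seteqP; split => w /=; rewrite leNgt => /negP.
rewrite probC; last exact: measurable_gt.
by have := h (n - k)%N (leq_subr _ _); lra.
Qed.

(* The greedy chain of first passages above [T], restarted after each passage, makes at least
   [r] steps within time [N]. *)
Fixpoint deep (T : R) (r N : nat) : set (Seq Z) :=
  if r is r'.+1 then
    [set w | exists k, (k < N.+1)%N /\
       (first_passage T k `&` seq_shift k @^-1` deep T r' (N - k)) w]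
  else setT.

Lemma measurable_deep T r N : measurable (deep T r N).
Proof.
elim: r N => [|r IH] N //=.
rewrite [X in measurable X](_ : _ = \bigcup_(k in [set k | (k < N.+1)%N])
   (first_passage T k `&` seq_shift k @^-1` deep T r (N - k))).
  apply: bigcup_measurable => k _; apply: measurableI.
    exact: measurable_first_passage.
  exact: measurable_preshift.
by apply/seteqP; split => w /= [k]; [case=> kn h; exists k|move=> kn h; exists k].
Qed.

(* Exponential Chebyshev inequality for the time of the [r]-th passage of the chain. *)
Lemma prob_deep (T c : R) r N : 0 <= c ->
  (forall n, \sum_(k < n.+1) Pr (first_passage T k) * expR (- (c * k%:R)) <= 1 / 2) ->
  Pr (deep T r N) <= (1 / 2) ^+ r * expR (c * N%:R).
Proof.
move=> c0 h; elim: r N => [|r IH] N.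
  by rewrite expr0 mul1r /= probT -expR0 ler_expR mulr_ge0.
pose A k := first_passage T k `&` seq_shift k @^-1` deep T r (N - k).
have mA k : measurable (A k).
  apply: measurableI; first exact: measurable_first_passage.
  by apply: measurable_preshift; exact: measurable_deep.
have le1 : Pr (deep T r.+1 N) <= \sum_(k < N.+1) Pr (A k).
  by apply: prob_le_sum => //; exact: measurable_deep.
apply: (le_trans le1).
have le2 : \sum_(k < N.+1) Pr (A k) <=
    \sum_(k < N.+1) (Pr (first_passage T k) * expR (- (c * k%:R))) *
       ((1 / 2) ^+ r * expR (c * N%:R)).
  apply: ler_sum => -[k /= kN] _; rewrite /A prob_indep; last 3 first.
  - exact: dep_first_passage.
  - exact: measurable_first_passage.
  - exact: measurable_deep.
  rewrite -mulrA ler_wpM2l ?prob_ge0 // (le_trans (IH _)) //.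
  rewrite mulrCA ler_wpM2l ?exprn_ge0 // -expRD ler_expR natrB //.
  by rewrite mulrBr addrC.
apply: (le_trans le2); rewrite -mulr_suml exprS -mulrA.
by rewrite ler_wpM2r // mulr_ge0 ?exprn_ge0 ?expR_ge0.
Qed.

Lemma laplace_first_passage (T : R) m : (0 < m)%N -> Pr (exceeds T m) <= 1 / 8 ->
  forall n, \sum_(k < n.+1) Pr (first_passage T k) * expR (- (ln 4 / m%:R * k%:R)) <= 1 / 2.
Proof.
move=> m0 h n; have mR : 0 < m%:R :> R by rewrite ltr0n.
have ln4 : 0 <= ln 4 :> R by rewrite ln_ge0 //; lra.
have c0 : 0 <= ln 4 / m%:R :> R by rewrite divr_ge0.
have step k : Pr (first_passage T k) * expR (- (ln 4 / m%:R * k%:R)) <=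
    (if (k < m.+1)%N then Pr (first_passage T k) else 0) + Pr (first_passage T k) * (1 / 4).
  case: ifPn => km.
    have : expR (- (ln 4 / m%:R * k%:R)) <= 1 :> R.
      by rewrite -[leRHS]expR0 ler_expR oppr_le0 mulr_ge0.
    by move=> e1; rewrite (le_trans (ler_piMr _ e1)) ?prob_ge0 // lerDl mulr_ge0 ?prob_ge0 //; lra.
  rewrite add0r ler_wpM2l ?prob_ge0 //.
  have -> : 1 / 4 = expR (- ln 4) :> R by rewrite expRN lnK ?posrE //; lra.
  rewrite ler_expR lerN2 -mulrA ler_peMr // mulrC ler_pdivlMr // mul1r ler_nat.
  by rewrite ltnW // ltnNge -ltnS.
apply: le_trans (ler_sum _ (fun (k : 'I_n.+1) _ => step k)) _.
rewrite big_split /= -mulr_suml.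
have le1 : \sum_(k < n.+1) Pr (first_passage T k) <= 1.
  by apply: (le_trans (sum_first_passage_le _ _)); apply: prob_le1; exact: measurable_exceeds.
suff : \sum_(k < n.+1) (if (k < m.+1)%N then Pr (first_passage T k) else 0) <= 1 / 8.
  by lra.
apply: le_trans h; apply: le_trans (sum_first_passage_le _ _).
rewrite -big_mkcond /= -(big_mkord (fun k => k < m.+1)%N (fun k => Pr (first_passage T k))).
rewrite -(big_mkord predT (fun k => Pr (first_passage T k))).
rewrite [leRHS](big_nat_widen _ _ (n.+1 + m.+1)) ?leq_addl //.
rewrite [leLHS](big_nat_widen _ _ (n.+1 + m.+1)) ?leq_addr //.
rewrite [leLHS]big_mkcond [leRHS]big_mkcond; apply: ler_sum => k _ /=.
by case: (k < m.+1)%N; case: (k < n.+1)%N => //=; rewrite prob_ge0.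
Qed.

Definition jump (i : nat) (w : Seq Z) : R := D 1 (seq_shift i w).

Lemma greedy_bound (T : R) r N n w : 0 <= T -> (n <= N)%N -> ~ deep T r N w ->
  exists s : seq nat, [/\ uniq s, all (fun i => i < N)%N s, (size s <= r)%N &
    D n w <= r%:R * T + \sum_(i <- s) jump i w].
Proof.
move=> T0; elim: r N n w => [|r IH] N n w nN; first by case.
move=> ndeep.
have [/exceeds_first [k [kn fk]]|nex] := pselect (exceeds T n w); last first.
  exists [::]; split => //; rewrite big_nil addr0.
  have : D n w <= T by rewrite leNgt; apply/negP => h; apply: nex; exists n.
  have : 0 <= r%:R * T by rewrite mulr_ge0.
  by rewrite mulrSr mulrDl mul1r; lra.
rewrite ltnS in kn.
have kN : (k <= N)%N by exact: leq_trans nN.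
have k0 : (0 < k)%N.
  by rewrite lt0n; apply/eqP => k0; move: fk.2; rewrite k0 D0 ltNge T0.
have [|s [us sN ss Ds]] := IH (N - k)%N (n - k)%N (seq_shift k w) (leq_sub2r _ nN).
  by move=> h; apply: ndeep; exists k; split.
exists (k.-1 :: map (addn k) s); split.
- rewrite /= map_inj_uniq ?us ?andbT //; last exact: addnI.
  by apply/mapP => -[i _ ki]; move: (leq_addr i k); rewrite -ki -{1}(prednK k0) ltnn.
- rewrite /= (leq_trans _ kN) ?prednK //=; apply/allP => _ /mapP [i /(allP sN) iN ->].
  by rewrite -ltn_subRL.
- by rewrite /= size_map ltnS.
rewrite big_cons big_map.
have -> : \sum_(j <- s) jump (k + j) w = \sum_(j <- s) jump j (seq_shift k w).
  by apply: eq_bigr => j _; rewrite /jump seq_shift_add.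
have := Dadd k (n - k) w; rewrite subnKC //.
have := Dadd k.-1 1 w; rewrite addn1 prednK //.
have : D k.-1 w <= T by apply: fk.1; rewrite prednK.
rewrite -/(jump k.-1 w) mulrSr mulrDl mul1r; lra.
Qed.

Definition many_jumps (y : R) (j N : nat) : set (Seq Z) :=
  [set w | (j <= count (fun i => (y < jump i w)%R) (iota 0 N))%N].

Lemma many_jumpsS (y : R) j N :
  many_jumps y j.+1 N.+1 =
  ([set w | y < D 1 w] `&` seq_shift 1 @^-1` many_jumps y j N) `|`
   seq_shift 1 @^-1` many_jumps y j.+1 N.
Proof.
have cE w : count (fun i => (y < jump i w)%R) (iota 0 N.+1) =
    ((y < D 1 w)%R + count (fun i => (y < jump i (seq_shift 1 w))%R) (iota 0 N))%N.
  rewrite /= -[X in iota X]addn0 iotaDl count_map; congr (_ + _)%N.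
have mE w : many_jumps y j.+1 N.+1 w = (j.+1 <= (y < D 1 w)%R +
    count (fun i => (y < jump i (seq_shift 1 w))%R) (iota 0 N))%N :> Prop.
  by rewrite -cE.
apply/seteqP; split => w; rewrite mE.
  case: (boolP (y < D 1 w)) => h; rewrite ?add0n => h'; last by right.
  by left; split.
by move=> [[/= -> h']|/= h] //; rewrite (leq_trans h) ?leq_addl.
Qed.

Lemma measurable_many_jumps (y : R) j N : measurable (many_jumps y j N).
Proof.
elim: N j => [|N IH] [|j].
- by rewrite (_ : many_jumps _ _ _ = setT) //; apply/seteqP; split.
- by rewrite (_ : many_jumps _ _ _ = set0) //; apply/seteqP; split.
- by rewrite (_ : many_jumps _ _ _ = setT) //; apply/seteqP; split.
- rewrite many_jumpsS; apply: measurableU; last exact: measurable_preshift.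
  apply: measurableI; first exact: measurable_gt.
  exact: measurable_preshift.
Qed.

Lemma dep_gt n (t : R) : dep n [set w | t < D n w].
Proof. by move=> w w' /depD /= ->. Qed.

Lemma prob_many_jumps (y : R) j N :
  Pr (many_jumps y j N) <= 'C(N, j)%:R * Pr [set w | y < D 1 w] ^+ j.
Proof.
elim: N j => [|N IH] [|j].
- by rewrite bin0 expr0 mulr1 prob_le1 //; exact: measurable_many_jumps.
- rewrite (_ : many_jumps _ _ _ = set0); last by apply/seteqP; split.
  by rewrite prob0 mulr_ge0 // exprn_ge0 // prob_ge0.
- by rewrite bin0 expr0 mulr1 prob_le1 //; exact: measurable_many_jumps.
have mM := measurable_many_jumps.
have mP k i : measurable (seq_shift k @^-1` many_jumps y i N) by exact: measurable_preshift.
have mg : measurable [set w | y < D 1 w] by exact: measurable_gt.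
rewrite many_jumpsS binS natrD mulrDl.
set A := _ `&` _; have mA : measurable A by exact: measurableI.
have mB := mP 1%N j.+1.
apply: (le_trans (prob_le_setU P (measurableU _ _ mA mB) mA mB (@subset_refl _ _))).
rewrite [leRHS]addrC lerD //; last by rewrite prob_shift // IH.
rewrite /A prob_indep //; last exact: dep_gt.
by rewrite exprS mulrCA ler_wpM2l ?prob_ge0.
Qed.

(* The smallest of the [r] values is at most [y r.-1], since at most [r.-1] of them exceed that
   level; remove it and induct. *)
Lemma sum_le_levels (f : nat -> R) (y : nat -> R) N r (s : seq nat) :
  (forall j, 0 <= y j) -> uniq s -> all (fun i => i < N)%N s -> (size s <= r)%N ->
  (forall j, (j < r)%N -> (count (fun i => (y j < f i)%R) (iota 0 N) <= j)%N) ->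
  \sum_(i <- s) f i <= \sum_(j < r) y j.
Proof.
move=> y0; elim: r s => [|r IH] s us sN ss h.
  by move: ss; rewrite leqn0 => /nilP ->; rewrite big_nil big_ord0.
rewrite big_ord_recr /=.
have h' j : (j < r)%N -> (count (fun i => (y j < f i)%R) (iota 0 N) <= j)%N.
  by move=> jr; apply: h; rewrite ltnS ltnW.
move: ss; rewrite leq_eqVlt => /orP[/eqP ss|ss]; last first.
  by apply: (le_trans (IH s us sN ss h')); rewrite lerDl.
have [i si fi] : exists2 i, i \in s & f i <= y r.
  apply: contrapT => no; have := h r (ltnSn r).
  rewrite leqNgt => /negP; apply.
  rewrite -ss -(_ : count (fun i => (y r < f i)%R) s = size s); last first.
    apply/eqP; rewrite -all_count; apply/allP => i si; rewrite /= ltNge.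
    by apply/negP => fi; apply: no; exists i.
  rewrite -!size_filter; apply: uniq_leq_size; first exact: filter_uniq.
  move=> i; rewrite !mem_filter => /andP[-> /(allP sN)]; rewrite mem_iota add0n.
  by move=> /= ->.
rewrite (big_rem i) //= addrC lerD //; apply: IH => //.
- exact: rem_uniq.
- by apply/allP => k /mem_rem /(allP sN).
- by rewrite size_rem // ss.
Qed.

End Process.

(** * Bounded law of the iterated logarithm *)

Section Elementary.
Context {R : realType}.

(* Of the order of the iterated logarithm of [2 ^ k], and never zero. *)
Definition blog (k : nat) : nat := (trunc_log 2 k.+1).+1.

Lemma leq_blog k k' : (k <= k')%N -> (blog k <= blog k')%N.
Proof. by move=> kk; rewrite ltnS leq_trunc_log. Qed.

Lemma pow_blog_gt k : (k.+1 < 2 ^ blog k)%N.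
Proof. exact: trunc_log_ltn. Qed.

Lemma pow_blog_le k : (2 ^ (blog k).-1 <= k.+1)%N.
Proof. exact: trunc_logP. Qed.

Lemma sum_inv_sqrt_le n : \sum_(j < n) (Num.sqrt j.+1%:R)^-1 <= 2 * Num.sqrt n%:R :> R.
Proof.
elim: n => [|n IH]; first by rewrite big_ord0 mulr_ge0.
rewrite big_ord_recr /=.
set a := Num.sqrt n%:R in IH *; set b := Num.sqrt n.+1%:R.
have b0 : 0 < b by rewrite sqrtr_gt0.
have a0 : 0 <= a by exact: sqrtr_ge0.
have : a ^+ 2 + 1 = b ^+ 2 by rewrite !sqr_sqrtr // natr1.
move=> ab; have : b^-1 <= 2 * (b - a).
  rewrite -(ler_pM2l b0) mulfV ?gt_eqF //.
  have : 0 <= (b - a) ^+ 2 by exact: sqr_ge0.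
  by nra.
by move: IH; lra.
Qed.

Lemma sum_inv_sqr_le n : \sum_(k < n) (k.+1%:R ^+ 2)^-1 <= 2 :> R.
Proof.
suff : \sum_(k < n.+1) (k.+1%:R ^+ 2)^-1 <= 2 - n.+1%:R^-1 :> R.
  rewrite big_ord_recr /= => h; rewrite -(lerD2r (n.+1%:R ^+ 2)^-1).
  by rewrite (le_trans h) // lerD2l (@le_trans _ _ 0) // oppr_le0 invr_ge0.
elim: n => [|n IH]; first by rewrite big_ord_recr big_ord0 /= expr1n invr1; lra.
rewrite big_ord_recr /=; set x : R := n.+2%:R.
have xE : n.+1%:R = x - 1 :> R by rewrite /x -[n.+2%:R]natr1 addrK.
have x1 : 1 < x by rewrite /x ltr1n.
rewrite xE in IH; move: IH.
have : (x ^+ 2)^-1 <= (x - 1)^-1 - x^-1.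
  have -> : (x - 1)^-1 - x^-1 = ((x - 1) * x)^-1.
    by field; rewrite subr_eq0 !gt_eqF //; lra.
  rewrite lef_pV2 ?posrE; nra.
move=> h1 h2; by rewrite (le_trans (lerD h2 h1)) // addrA subrK.
Qed.

Lemma sum_half_pow_le n : \sum_(j < n) (1 / 2) ^+ j <= 2 :> R.
Proof.
suff -> : \sum_(j < n) (1 / 2) ^+ j = 2 - 2 * (1 / 2) ^+ n :> R.
  by have : 0 <= (1 / 2 : R) ^+ n by [rewrite exprn_ge0]; lra.
elim: n => [|n IH]; first by rewrite big_ord0 expr0; lra.
by rewrite big_ord_recr /= IH exprS; lra.
Qed.

Lemma pow_le_fact n : n%:R ^+ n <= n`!%:R * expR 1 ^+ n :> R.
Proof.
case: n => [|n]; first by rewrite !expr0 mulr1.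
have f0 : 0 < n.+1`!%:R :> R by rewrite ltr0n fact_gt0.
rewrite -expRM_natl mulr1 mulrC -ler_pdivrMr //.
by apply: (le_trans _ (expR_ge1Dxn n (ler0n R n.+1))); rewrite lerDr.
Qed.

Lemma bin_le_fact N j : 'C(N, j)%:R * j`!%:R <= N%:R ^+ j :> R.
Proof.
rewrite -natrM bin_ffact -natrX ler_nat ffact_prod.
rewrite -[X in (_ <= _ ^ X)%N]card_ord -prod_nat_const.
by apply: leq_prod => i _; exact: leq_subr.
Qed.

Lemma binomial_tail_le (N j : nat) (q delta : R) :
  0 <= q -> N%:R * q <= j.+1%:R * delta ->
  'C(N, j.+1)%:R * q ^+ j.+1 <= N%:R * q * expR 1 * (delta * expR 1) ^+ j.
Proof.
move=> q0 Nq; have f0 : 0 < j.+1`!%:R :> R by rewrite ltr0n fact_gt0.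
have Nq0 : 0 <= N%:R * q by rewrite mulr_ge0.
rewrite -(ler_pM2r f0).
have -> : 'C(N, j.+1)%:R * q ^+ j.+1 * j.+1`!%:R =
  'C(N, j.+1)%:R * j.+1`!%:R * q ^+ j.+1 by ring.
apply: (le_trans (ler_wpM2r (exprn_ge0 _ q0) (bin_le_fact _ _))).
rewrite -exprMn; move: (N%:R * q) Nq Nq0 => t Nq Nq0.
rewrite exprS -!mulrA ler_wpM2l //.
apply: (@le_trans _ _ ((j.+1%:R * delta) ^+ j)).
  by rewrite lerXn2r ?nnegrE // (le_trans Nq0).
have d0 : 0 <= delta by move: (le_trans Nq0 Nq); rewrite pmulr_rge0.
have := pow_le_fact j.+1; rewrite !exprS !exprMn => h.
have -> : expR 1 * (delta ^+ j * expR 1 ^+ j * j.+1`!%:R) =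
  delta ^+ j * (j.+1`!%:R * (expR 1 * expR 1 ^+ j)) by ring.
rewrite mulrC ler_wpM2l ?exprn_ge0 //; apply: le_trans h.
by rewrite ler_peMl ?exprn_ge0 // ler1n.
Qed.

End Elementary.

Section BoundedLIL.
Context {Z : ptopologicalType} {R : realType} (P : probability (Seq Z) R).
Local Notation Pr := (prob P).

Hypothesis Pind : forall k (A B : set (Seq Z)), dep k A -> measurable A ->
  measurable B -> P (A `&` seq_shift k @^-1` B) = (P A * P B)%E.

Variable D : nat -> Seq Z -> R.
Hypothesis D0 : forall w, D 0 w = 0.
Hypothesis mD : forall n, measurable_fun setT (D n).
Hypothesis depD : forall n (w w' : Seq Z),
  (forall i, (i < n)%N -> w i = w' i) -> D n w = D n w'.
Hypothesis Dadd : forall a b w, D (a + b) w <= D a w + D b (seq_shift a w).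
Hypothesis Dl : forall a b w, D a w <= D (a + b) w + D b (seq_shift a w).
Hypothesis Dr : forall a b w, D b (seq_shift a w) <= D a w + D (a + b) w.
Hypothesis tight : forall e : R, 0 < e -> exists2 M, 0 < M &
  forall n, Pr [set w | M * Num.sqrt n%:R < D n w] <= e.

Let mgt := measurable_gt mD.

Lemma tight_exceeds : exists2 t0, 0 < t0 &
  forall m, Pr (exceeds D (t0 * Num.sqrt m%:R) m) <= 1 / 8.
Proof.
have [|M M0 hM] := tight (e := 1 / 16); first lra.
exists (2 * M) => [|m]; first lra.
have h k : (k <= m)%N -> Pr [set w | M * Num.sqrt m%:R < D k w] <= 1 / 16.
  move=> km; apply: le_trans (hM k); apply: le_prob; try exact: mgt.
  move=> w /=; apply: le_lt_trans; rewrite ler_pM2l //.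
  by rewrite ler_wsqrtr // ler_nat.
rewrite -mulrA; apply: (le_trans (ottaviani Pind mD depD Dl _)).
  by move=> k km; apply: (le_trans (h k km)); lra.
by have := h m (leqnn m); lra.
Qed.

Lemma prob_no_jump (y : R) N :
  Pr (~` many_jumps D y 1 N) = (1 - Pr [set w | y < D 1 w]) ^+ N.
Proof.
elim: N => [|N IH].
  rewrite expr0 (_ : ~` _ = setT) ?probT //.
  by apply/seteqP; split => // w _ /=; rewrite /many_jumps.
have mM := measurable_many_jumps mD y.
rewrite many_jumpsS setCU.
have -> : many_jumps D y 0 N = setT by apply/seteqP; split.
rewrite preimage_setT setIT preimage_setC.
rewrite (prob_indep Pind); last 3 first.
- by move=> w w' /depD /= ->.
- exact: measurableC.
- exact: measurableC.
by rewrite IH probC ?exprS //; exact: mgt.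
Qed.

(* A jump above [2 * t] before time [m] forces the process above [t], so the probability [q] of
   a jump above [2 * t0 * sqrt m] satisfies [(1 - q) ^ m >= 7 / 8]. *)
Lemma weak_L2 : exists2 C0, 0 < C0 & forall y, 0 < y -> Pr [set w | y < D 1 w] <= C0 / y ^+ 2.
Proof.
have [t0 t00 ht0] := tight_exceeds.
have key m : Pr [set w | 2 * (t0 * Num.sqrt m%:R) < D 1 w] * m%:R <= 1.
  set c := t0 * _; set q := Pr _.
  have q1 : q <= 1 by apply: prob_le1; exact: mgt.
  have q0 : 0 <= q by exact: prob_ge0.
  have mM := measurable_many_jumps mD (2 * c) 1 m.
  have : Pr (many_jumps D (2 * c) 1 m) <= 1 / 8.
    apply: le_trans (ht0 m); apply: le_prob => //; first exact: measurable_exceeds.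
    move=> w; rewrite /many_jumps /= -has_count => /hasP [i].
    rewrite mem_iota add0n /= => im; rewrite /jump => h.
    have := Dr i 1 w; rewrite addn1 => h'.
    have [ci|ci] := ltP c (D i w); first by exists i; rewrite ltnW.
    by exists i.+1; split => //; rewrite -/c; lra.
  have := prob_no_jump (2 * c) m; rewrite probC // -/q => qE h1.
  have e0 : (1 - q) ^+ m <= expR (- (q * m%:R)).
    rewrite mulrC -mulrN expRM_natl lerXn2r ?nnegrE ?expR_ge0 ?subr_ge0 //.
    exact: expR_ge1Dx.
  have : expR (q * m%:R) * expR (- (q * m%:R)) = 1 by rewrite -expRD subrr expR0.
  have := expR_ge1Dx (q * m%:R); have := expR_gt0 (q * m%:R).
  rewrite -qE in e0; move: e0 h1; nra.
exists (2 * (2 * t0) ^+ 2) => [|y y0]; first by rewrite mulr_gt0 // exprn_gt0 //; lra.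
have c0 : 0 < 2 * t0 by lra.
set x := (y / (2 * t0)) ^+ 2.
have x0 : 0 <= x by exact: sqr_ge0.
have -> : 2 * (2 * t0) ^+ 2 / y ^+ 2 = 2 / x.
  by rewrite /x; field; rewrite !gt_eqF.
have xpos : 0 < x by rewrite exprn_gt0 // divr_gt0.
have /andP[m1 m2] := truncn_itv x0.
rewrite ler_pdivlMr //.
have [mz|mpos] := posnP (Num.truncn x).
  have q1 : Pr [set w | y < D 1 w] <= 1 by apply: prob_le1; exact: mgt.
  have q0 : 0 <= Pr [set w | y < D 1 w] by exact: prob_ge0.
  by move: m2; rewrite mz; nra.
have := key (Num.truncn x).
have : Pr [set w | y < D 1 w] <=
    Pr [set w | 2 * (t0 * Num.sqrt (Num.truncn x)%:R) < D 1 w].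
  apply: le_prob; try exact: mgt.
  move=> w /=; apply: le_lt_trans; rewrite mulrA -ler_pdivlMl // mulrC.
  have -> : y / (2 * t0) = Num.sqrt x by rewrite sqrtr_sqr ger0_norm // divr_ge0 ?ltW.
  exact: ler_wsqrtr.
have : 0 <= Pr [set w | y < D 1 w] by exact: prob_ge0.
have : 1 <= (Num.truncn x)%:R :> R by rewrite ler1n.
move: m2; rewrite -natr1.
have aux (a b t z : R) : z < t + 1 -> 1 <= t -> 0 <= a -> a <= b -> b * t <= 1 -> a * z <= 2.
  by nra.
exact: aux.
Qed.


Definition hpow (k : nat) : R := Num.sqrt (2 ^ k)%N%:R.

Lemma hpow_gt0 k : 0 < hpow k.
Proof. by rewrite sqrtr_gt0 ltr0n expn_gt0. Qed.

Lemma sqr_hpow k : hpow k ^+ 2 = (2 ^ k)%N%:R.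
Proof. by rewrite sqr_sqrtr. Qed.

(* Threshold for the [j.+1]-st largest jump among the first [2 ^ k * blog k] ones: by the weak
   second moment bound, the first summand makes the probability of an excess geometric in [j];
   the second one makes it summable in [k] when [phiLL] of a jump is integrable. *)
Definition level (K : R) (k j : nat) : R :=
  hpow k * K * (Num.sqrt (blog k)%:R / Num.sqrt j.+1%:R + (blog k)%:R * (1 / 2) ^+ j).

Lemma level_gt0 K k j : 0 < K -> 0 < level K k j.
Proof.
move=> K0; rewrite !mulr_gt0 ?hpow_gt0 // addr_gt0 //.
  by rewrite divr_gt0 // sqrtr_gt0.
by rewrite mulr_gt0 // exprn_gt0.
Qed.

Definition bad (t0 K : R) (k : nat) : set (Seq Z) :=
  deep D (t0 * hpow k) (4 * blog k) (2 ^ k * blog k) `|`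
  [set w | exists j, (j < 4 * blog k)%N /\
     many_jumps D (level K k j) j.+1 (2 ^ k * blog k) w].

Lemma measurable_some_jumps K k : measurable [set w | exists j, (j < 4 * blog k)%N /\
     many_jumps D (level K k j) j.+1 (2 ^ k * blog k) w].
Proof.
rewrite [X in measurable X](_ : _ = \bigcup_(j in [set j | (j < 4 * blog k)%N])
   many_jumps D (level K k j) j.+1 (2 ^ k * blog k)).
  by apply: bigcup_measurable => j _; exact: measurable_many_jumps.
by apply/seteqP; split => w /= [j]; [case=> jn h; exists j|move=> jn h; exists j].
Qed.

Lemma measurable_bad t0 K k : measurable (bad t0 K k).
Proof. by apply: measurableU; [exact: measurable_deep|exact: measurable_some_jumps]. Qed.

Lemma prob_deep_dyadic t0 k : 0 < t0 ->
  (forall m, Pr (exceeds D (t0 * Num.sqrt m%:R) m) <= 1 / 8) ->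
  Pr (deep D (t0 * hpow k) (4 * blog k) (2 ^ k * blog k)) <= (k.+1%:R ^+ 2)^-1.
Proof.
move=> t00 ht0; have m0 : (0 < 2 ^ k)%N by rewrite expn_gt0.
have l4 : 0 <= ln 4 / (2 ^ k)%N%:R :> R by rewrite divr_ge0 // ln_ge0 //; lra.
have := prob_deep Pind mD depD (4 * blog k) (2 ^ k * blog k) l4
  (laplace_first_passage mD m0 (ht0 _)).
move=> h; apply: (le_trans h).
have -> : ln 4 / (2 ^ k)%N%:R * (2 ^ k * blog k)%N%:R = (blog k)%:R * ln 4 :> R.
  have a0 : (2 ^ k)%N%:R != 0 :> R by rewrite pnatr_eq0 -lt0n.
  by rewrite natrM mulrA (divfK a0) mulrC.
rewrite expRM_natl lnK ?posrE; last by lra.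
rewrite exprM -exprMn (_ : (1 / 2) ^+ 4 * 4 = 4^-1); last by field.
rewrite exprVn lef_pV2 ?posrE ?exprn_gt0 //.
have -> : 4 ^+ blog k = (2 ^ blog k)%N%:R ^+ 2 :> R.
  by rewrite natrX -exprM mulnC exprM; congr (_ ^+ _); rewrite expr2 -natrM.
by rewrite lerXn2r ?nnegrE // ler_nat; exact/ltnW/pow_blog_gt.
Qed.

Lemma prob_many_jumps_level (K C0 : R) k j : 1 <= K -> 8 * C0 * expR 1 <= K ^+ 2 ->
  (forall y, 0 < y -> Pr [set w | y < D 1 w] <= C0 / y ^+ 2) ->
  Pr (many_jumps D (level K k j) j.+1 (2 ^ k * blog k)) <=
  expR 1 * (1 / 8) ^+ j *
  ((2 ^ k * blog k)%N%:R * Pr [set w | (1 / 2) ^+ j * hpow k * (blog k)%:R < D 1 w]).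
Proof.
move=> K1 hK hC0; have K0 : 0 < K by lra.
apply: (le_trans (prob_many_jumps Pind mD depD _ _ _)).
set q := Pr _; set q' := Pr _; set N := (2 ^ k * blog k)%N.
have q0 : 0 <= q by exact: prob_ge0.
have qq' : q <= q'.
  apply: le_prob; try exact: mgt.
  move=> w /=; apply: le_lt_trans; rewrite /level.
  have : 0 <= Num.sqrt (blog k)%:R / Num.sqrt j.+1%:R :> R by rewrite divr_ge0.
  have : 0 <= (blog k)%:R * (1 / 2) ^+ j :> R by rewrite mulr_ge0 // exprn_ge0.
  have := ltW (hpow_gt0 k).
  have aux (h p b a : R) : 0 <= h -> 0 <= b * p -> 0 <= a -> p * h * b <= h * K * (a + b * p).
    move=> h0 bp a0; have -> : p * h * b = h * (1 * (b * p)) by ring.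
    by rewrite -mulrA ler_wpM2l // ler_pM // lerDr.
  by move=> h0 bp a0; exact: aux.
have NqK : N%:R * q <= j.+1%:R * (C0 / K ^+ 2).
  have := hC0 _ (level_gt0 k j K0); rewrite -/q => hq.
  have C00 : 0 <= C0.
    have := le_trans q0 hq; rewrite pmulr_lge0 // invr_gt0 exprn_gt0 //.
    exact: level_gt0.
  apply: (@le_trans _ _ (N%:R * (C0 / level K k j ^+ 2))); first by rewrite ler_wpM2l.
  rewrite [leLHS]mulrCA [leRHS]mulrCA ler_wpM2l //.
  have l0 : 0 < (hpow k * K * (Num.sqrt (blog k)%:R / Num.sqrt j.+1%:R)) ^+ 2.
    by rewrite exprn_gt0 // !mulr_gt0 ?hpow_gt0 // ?invr_gt0 sqrtr_gt0.
  apply: (@le_trans _ _ (N%:R / (hpow k * K * (Num.sqrt (blog k)%:R / Num.sqrt j.+1%:R)) ^+ 2)).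
    have a0 : 0 < hpow k * K * (Num.sqrt (blog k)%:R / Num.sqrt j.+1%:R).
      by rewrite !mulr_gt0 ?hpow_gt0 // ?invr_gt0 sqrtr_gt0.
    have l1 := level_gt0 k j K0.
    rewrite ler_wpM2l // lef_pV2 ?posrE ?exprn_gt0 //.
    rewrite lerXn2r ?nnegrE ?(ltW a0) ?(ltW l1) //.
    rewrite ler_wpM2l ?mulr_ge0 ?(ltW K0) ?(ltW (hpow_gt0 k)) // lerDl mulr_ge0 //.
  rewrite !exprMn sqr_hpow exprVn !sqr_sqrtr // /N natrM.
  rewrite le_eqVlt; apply/orP; left; apply/eqP; field.
  by rewrite !gt_eqF // ltr0n // expn_gt0.
have d8 : C0 / K ^+ 2 * expR 1 <= 1 / 8.
  by rewrite mulrAC ler_pdivrMr ?exprn_gt0 //; lra.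
have d0 : 0 <= C0 / K ^+ 2.
  have := le_trans (mulr_ge0 (ler0n R N) q0) NqK.
  by rewrite pmulr_rge0.
apply: (le_trans (binomial_tail_le q0 NqK)).
have e0 : 0 <= expR 1 :> R by exact: expR_ge0.
have de0 : 0 <= C0 / K ^+ 2 * expR 1 by rewrite mulr_ge0.
have N0 : 0 <= N%:R :> R by [].
have -> : expR 1 * (1 / 8) ^+ j * (N%:R * q') = N%:R * q' * expR 1 * (1 / 8) ^+ j by ring.
apply: ler_pM.
- by rewrite !mulr_ge0.
- by rewrite exprn_ge0.
- by rewrite ler_wpM2r // ler_wpM2l.
- by rewrite lerXn2r // nnegrE; lra.
Qed.

Variable C1 : R.
Hypothesis tail : forall s : R, 0 < s <= 1 -> forall n,
  \sum_(k < n) (2 ^ k * blog k)%N%:R * Pr [set w | s * hpow k * (blog k)%:R < D 1 w]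
  <= C1 / s ^+ 2.

Lemma sum_prob_bad t0 K C0 n : 0 < t0 ->
  (forall m, Pr (exceeds D (t0 * Num.sqrt m%:R) m) <= 1 / 8) ->
  1 <= K -> 8 * C0 * expR 1 <= K ^+ 2 ->
  (forall y, 0 < y -> Pr [set w | y < D 1 w] <= C0 / y ^+ 2) ->
  \sum_(k < n) Pr (bad t0 K k) <= 2 + 2 * (expR 1 * C1).
Proof.
move=> t00 ht0 K1 hK hC0.
pose q k j := (2 ^ k * blog k)%N%:R * Pr [set w | (1 / 2) ^+ j * hpow k * (blog k)%:R < D 1 w].
have q0 k j : 0 <= q k j by rewrite mulr_ge0 ?prob_ge0.
pose J := (4 * blog n)%N.
have step (k : 'I_n) : Pr (bad t0 K k) <=
    (k.+1%:R ^+ 2)^-1 + \sum_(j < J) expR 1 * (1 / 8) ^+ j * q k j.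
  apply: (le_trans (prob_le_setU P (measurable_bad t0 K k) (measurable_deep mD _ _ _)
    (measurable_some_jumps K k) (@subset_refl _ _))).
  apply: lerD; first exact: prob_deep_dyadic.
  apply: (@le_trans _ _ (\sum_(j < J) Pr (many_jumps D (level K k j) j.+1 (2 ^ k * blog k)))).
    apply: (prob_le_sum P (A := fun j => many_jumps D (level K k j) j.+1 (2 ^ k * blog k))).
    - by move=> j; exact: measurable_many_jumps.
    - exact: measurable_some_jumps.
    - move=> w [j [jk h]]; exists j; split => //; apply: (leq_trans jk).
      by rewrite leq_mul2l leq_blog ?orbT // ltnW.
  apply: ler_sum => j _; exact: (prob_many_jumps_level k j K1 hK hC0).
apply: (le_trans (ler_sum _ (fun k _ => step k))).
rewrite big_split lerD ?sum_inv_sqr_le //=.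
rewrite exchange_big /=.
apply: (@le_trans _ _ (\sum_(j < J) expR 1 * C1 * (1 / 2) ^+ j)).
  apply: ler_sum => j _; rewrite -mulr_sumr -!mulrA ler_wpM2l ?expR_ge0 //.
  have s1 : 0 < (1 / 2 : R) ^+ j <= 1 by rewrite exprn_gt0 // exprn_ile1 //; lra.
  have : \sum_(k < n) q k j <= _ := tail s1 n; move=> h.
  apply: (le_trans (ler_wpM2l _ h)); first by rewrite exprn_ge0.
  have -> : (1 / 8) ^+ j = (1 / 2) ^+ j * ((1 / 2) ^+ j) ^+ 2 :> R.
    by rewrite -exprM mulnC exprM -exprMn; congr (_ ^+ _); field.
  rewrite mulrCA -mulrA divff ?mulr1 // gt_eqF // !exprn_gt0 //.
rewrite -mulr_sumr mulrC ler_wpM2r ?sum_half_pow_le //.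
have := tail (s := 1); rewrite ltr01 lexx => /(_ isT 0%N).
by rewrite big_ord0 expr1n divr1 => ?; rewrite mulr_ge0 ?expR_ge0.
Qed.

Lemma not_bad_bound t0 K k n w : 0 < t0 -> 1 <= K -> (n <= 2 ^ k * blog k)%N ->
  ~ bad t0 K k w -> D n w <= (4 * t0 + 6 * K) * (hpow k * (blog k)%:R).
Proof.
move=> t00 K1 nN nb; have K0 : 0 < K by lra.
have T0 : 0 <= t0 * hpow k by rewrite mulr_ge0 ?ltW ?hpow_gt0.
have [|s [us sN ss Ds]] := greedy_bound D0 Dadd T0 nN (w := w) (r := (4 * blog k)%N).
  by move=> h; apply: nb; left.
have sl : \sum_(i <- s) jump D i w <= \sum_(j < 4 * blog k) level K k j.
  apply: sum_le_levels us sN ss _ => j.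
    by rewrite ltW // level_gt0.
  move=> jr; rewrite leqNgt; apply/negP => h; apply: nb; right.
  by exists j.
have sy : \sum_(j < 4 * blog k) level K k j <= 6 * K * (hpow k * (blog k)%:R).
  rewrite /level -mulr_sumr big_split /= -!mulr_sumr.
  have h1 := sum_inv_sqrt_le (R := R) (4 * blog k).
  have h2 := sum_half_pow_le (R := R) (4 * blog k).
  have e4 : Num.sqrt (4 * blog k)%N%:R = 2 * Num.sqrt (blog k)%:R :> R.
    rewrite natrM sqrtrM // (_ : 4%:R = 2 ^+ 2) ?sqrtr_sqr ?ger0_norm //.
    by rewrite expr2 -natrM.
  rewrite e4 in h1.
  have : Num.sqrt (blog k)%:R ^+ 2 = (blog k)%:R :> R by rewrite sqr_sqrtr.
  have b0 : 0 <= (blog k)%:R :> R by [].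
  have s0 : 0 <= Num.sqrt (blog k)%:R :> R by [].
  rewrite (_ : 6 * K * (hpow k * (blog k)%:R) = hpow k * K * (6 * (blog k)%:R)); last ring.
  move=> sE; apply: ler_wpM2l; first by rewrite mulr_ge0 ?(ltW K0) ?(ltW (hpow_gt0 k)).
  by move: (ler_wpM2l s0 h1) (ler_wpM2l b0 h2); lra.
by move: Ds sl sy; rewrite natrM; lra.
Qed.

Theorem bounded_lil : exists2 C, 0 < C & {ae P, forall w, exists k0, forall k n,
  (k0 <= k)%N -> (n <= 2 ^ k * blog k)%N -> D n w <= C * (hpow k * (blog k)%:R)}.
Proof.
have [t0 t00 ht0] := tight_exceeds.
have [C0 C00 hC0] := weak_L2.
pose K := Num.max 1 (Num.sqrt (8 * C0 * expR 1)).
have K1 : 1 <= K by rewrite le_max lexx.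
have hK : 8 * C0 * expR 1 <= K ^+ 2.
  have e0 : 0 <= 8 * C0 * expR 1 by rewrite !mulr_ge0 ?expR_ge0 // ltW.
  rewrite -[leLHS]sqr_sqrtr // lerXn2r ?nnegrE ?(le_trans ler01 K1) //.
  by rewrite le_max lexx orbT.
exists (4 * t0 + 6 * K); first lra.
have mB := measurable_bad t0 K.
exists (lim_sup_set (bad t0 K)); split.
- by apply: bigcapT_measurable => i; apply: bigcup_measurable => j _.
- apply: lim_sup_set_cvg0 => //.
  apply: (@le_lt_trans _ _ (2 + 2 * (expR 1 * C1))%:E); last exact: ltry.
  apply: lime_le; first by apply: is_cvg_nneseries => ? _ _.
  apply: nearW => n; rewrite big_mkord.
  rewrite (eq_bigr (fun k : 'I_n => (Pr (bad t0 K k))%:E)); last first.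
    by move=> i _; exact: probE.
  by rewrite sumEFin lee_fin (sum_prob_bad _ t00 ht0 K1 hK hC0).
- move=> w /= nw k0 _; apply: contrapT => nb; apply: nw; exists k0 => k n kk nN.
  apply: not_bad_bound => // bk; apply: nb; exists k => //.
Qed.

End BoundedLIL.

(** * The function phiLL *)

Section IteratedLog.
Context {R : realType}.
Implicit Types x y s t c : R.

Let e0 : 0 < expR 1 :> R. Proof. exact: expR_gt0. Qed.

Lemma max_e_gt0 x : 0 < Num.max x (expR 1).
Proof. by rewrite lt_max e0 orbT. Qed.

Lemma Logm_ge1 x : 1 <= Logm x.
Proof.
by rewrite /Logm -[leLHS](expRK 1) ler_ln ?posrE ?max_e_gt0 // le_max lexx orbT.
Qed.

Lemma Logm_gt0 x : 0 < Logm x.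
Proof. exact: lt_le_trans (Logm_ge1 x). Qed.

Lemma le_Logm x y : x <= y -> Logm x <= Logm y.
Proof.
move=> xy; rewrite /Logm ler_ln ?posrE ?max_e_gt0 //.
by rewrite ge_max !le_max xy lexx orbT.
Qed.

Lemma Logm_mul_le t x : 1 <= t -> Logm (t * x) <= t * Logm x.
Proof.
move=> t1; have t0 : 0 < t by lra.
have m0 := max_e_gt0 x.
apply: (@le_trans _ _ (ln (t * Num.max x (expR 1)))).
  rewrite /Logm ler_ln ?posrE ?mulr_gt0 ?max_e_gt0 // ge_max.
  rewrite ler_pM2l // le_max lexx /=.
  apply: (@le_trans _ _ (1 * expR 1)); first by rewrite mul1r.
  by rewrite ler_pM ?expR_ge0 // le_max lexx orbT.
rewrite lnM ?posrE // -/(Logm x).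
have lt : ln t <= t - 1.
  by have := expR_ge1Dx (ln t); rewrite lnK ?posrE //; lra.
have := Logm_ge1 x; nra.
Qed.

Lemma phiLL_ge0 x : 0 <= phiLL x.
Proof. by rewrite /phiLL divr_ge0 ?sqr_ge0 // ltW // Logm_gt0. Qed.

Lemma le_phiLL x y : 0 <= x -> x <= y -> phiLL x <= phiLL y.
Proof.
rewrite le_eqVlt => /predU1P[<- _|x0 xy].
  by rewrite [leLHS]/phiLL expr0n mul0r phiLL_ge0.
pose t := y / x; have yE : y = t * x by rewrite divfK ?gt_eqF.
have t1 : 1 <= t by rewrite /t ler_pdivlMr // mul1r.
have LL : Logm (Logm y) <= t * Logm (Logm x).
  apply: le_trans (Logm_mul_le _ t1); apply: le_Logm.
  by rewrite yE Logm_mul_le.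
rewrite /phiLL ler_pdivrMr ?Logm_gt0 // mulrAC ler_pdivlMr ?Logm_gt0 //.
apply: (@le_trans _ _ (x ^+ 2 * (t * Logm (Logm x)))); first by rewrite ler_wpM2l ?sqr_ge0.
rewrite yE exprMn mulrA ler_wpM2r ?(ltW (Logm_gt0 _)) // mulrC ler_wpM2r ?sqr_ge0 //.
by rewrite expr2 ler_peMl //; lra.
Qed.

Lemma phiLL_div_le x s : 0 <= x -> 0 < s <= 1 -> phiLL (x / s) <= phiLL x / s ^+ 2.
Proof.
move=> x0 /andP[s0 s1]; rewrite /phiLL exprMn exprVn [leRHS]mulrAC.
rewrite ler_wpM2l ?divr_ge0 ?sqr_ge0 // lef_pV2 ?posrE ?Logm_gt0 //.
by apply/le_Logm/le_Logm; rewrite ler_pdivlMr // ler_piMr.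
Qed.

Lemma phiLLD_le x y : 0 <= x -> 0 <= y -> phiLL (x + y) <= 4 * (phiLL x + phiLL y).
Proof.
move=> x0 y0.
wlog xy : x y x0 y0 / x <= y.
  move=> h; have [xy|/ltW yx] := leP x y; first exact: h.
  by rewrite addrC [in leRHS]addrC h.
apply: (@le_trans _ _ (phiLL (2 * y))); first by apply: le_phiLL; lra.
have : phiLL (2 * y) <= 4 * phiLL y.
  rewrite /phiLL mulrA exprMn; have -> : 2 ^+ 2 = 4 :> R by ring.
  rewrite ler_wpM2l ?mulr_ge0 ?sqr_ge0 // lef_pV2 ?posrE ?Logm_gt0 //.
  by apply/le_Logm/le_Logm; lra.
by have := phiLL_ge0 x; lra.
Qed.

Lemma phiLL_dyadic_ge k : (2 ^ k * blog k)%N%:R / 2 <= phiLL (hpow k * (blog k)%:R) :> R.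
Proof.
set L : R := (blog k)%:R; have L1 : 1 <= L by rewrite ler1n.
have hk1 : 1 <= (2 ^ k)%N%:R :> R by rewrite ler1n expn_gt0.
have h0 := @hpow_gt0 R k; have h2 := @sqr_hpow R k.
have ln2 : ln 2 <= 1 :> R.
  by rewrite -[leRHS](expRK 1) ler_ln ?posrE ?expR_gt0 //; have := expR_ge1Dx (1 : R); lra.
have LL : Logm (Logm (hpow k * L)) <= 2 * L.
  have x1 : hpow k * L <= 4 ^+ k.
    have Lk : L <= (2 ^ k)%N%:R.
      rewrite ler_nat; apply: (@leq_trans (2 ^ (blog k).-1)); first exact: ltn_expl.
      by apply: (leq_trans (pow_blog_le k)); exact: ltn_expl.
    have hh : hpow k <= (2 ^ k)%N%:R :> R.
      move: h0 h2 hk1; move: (hpow k) (2 ^ k)%N%:R => a b a0 ab b1.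
      suff a1 : 1 <= a by rewrite -ab expr2 ler_peMl // ltW.
      by rewrite leNgt; apply/negP => a1; move: b1; rewrite -ab leNgt expr_lt1 ?a1 // ltW.
    have -> : 4 ^+ k = (2 ^ k)%N%:R * (2 ^ k)%N%:R :> R.
      by rewrite natrX -exprMn; congr (_ ^+ _); ring.
    by rewrite ler_pM // ltW.
  have x2 : Logm (hpow k * L) <= 2 ^+ (blog k).+1.
    apply: (le_trans (le_Logm x1)).
    have ln4 : ln 4 <= 2 :> R.
      have -> : 4 = 2 * 2 :> R by ring.
      by rewrite lnM ?posrE //; lra.
    have l4 : Logm (4 ^+ k) <= 2 * k.+1%:R :> R.
      rewrite /Logm; case: (leP (4 ^+ k : R) (expR 1)) => _.
        by rewrite expRK; have : 1 <= k.+1%:R :> R by [rewrite ler1n]; lra.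
      rewrite lnXn // -[ln 4 *+ k]mulr_natr.
        apply: (@le_trans _ _ (2 * k%:R)); first by rewrite ler_wpM2r.
        by rewrite ler_wpM2l // ler_nat.
    apply: (le_trans l4); rewrite exprS ler_wpM2l // -natrX ler_nat.
    exact: ltnW (pow_blog_gt k).
  apply: (le_trans (le_Logm x2)); rewrite /Logm.
  have Ll : 1 <= L by [].
  case: (leP (2 ^+ (blog k).+1 : R) (expR 1)) => _; first by rewrite expRK; lra.
  rewrite lnXn // -[ln 2 *+ _]mulr_natr -[(blog k).+1%:R]natr1 -/L; nra.
rewrite /phiLL exprMn h2 natrM -/L ler_pdivlMr ?Logm_gt0 //.
apply: (@le_trans _ _ ((2 ^ k)%N%:R * L / 2 * (2 * L))); last by rewrite expr2; lra.
by rewrite ler_wpM2l // !mulr_ge0 //; lra.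
Qed.

Lemma sum_dyadic_le k : \sum_(i < k.+1) (2 ^ i * blog i)%N%:R <= 2 * (2 ^ k * blog k)%N%:R :> R.
Proof.
elim: k => [|k IH]; first by rewrite big_ord_recr big_ord0 /= add0r ler_peMl //; lra.
rewrite big_ord_recr /=; apply: (le_trans (lerD IH (lexx _))).
have : 2 * (2 ^ k * blog k)%N%:R <= (2 ^ k.+1 * blog k.+1)%N%:R :> R.
  by rewrite -natrM ler_nat expnS -mulnA !leq_mul // leq_blog.
by lra.
Qed.

Lemma sum_dyadic_indic_le n (z : R) : 0 <= z ->
  \sum_(k < n) (2 ^ k * blog k)%N%:R * (hpow k * (blog k)%:R < z)%R%:R <= 4 * phiLL z.
Proof.
move=> z0; elim: n => [|n IH]; first by rewrite big_ord0 mulr_ge0 // phiLL_ge0.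
case: (boolP (hpow n * (blog n)%:R < z)) => h; last first.
  by rewrite big_ord_recr /= (negbTE h) mulr0 addr0.
apply: (@le_trans _ _ (\sum_(i < n.+1) (2 ^ i * blog i)%N%:R)).
  by apply: ler_sum => i _; rewrite ler_piMr // lern1 leq_b1.
apply: (le_trans (sum_dyadic_le n)).
have x0 : 0 <= hpow n * (blog n)%:R :> R by rewrite mulr_ge0 // ltW // hpow_gt0.
have := le_phiLL x0 (ltW h); have := phiLL_dyadic_ge n; lra.
Qed.

End IteratedLog.

(** * Suprema of empirical sums *)

Section SupProcess.
Context {Z : ptopologicalType} {R : realType}.
Local Notation ZB := (Borel Z).
Variables (f : nat -> ZB -> R) (H : ZB -> R).
Hypothesis mf : forall j, measurable_fun setT (f j).
Hypothesis fH : forall j z, `|f j z| <= H z.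

Definition psum (j n : nat) (w : Seq Z) : R := \sum_(i < n) f j (w i).

Definition sup_psum (n : nat) (w : Seq Z) : R := sup (range (fun j => `|psum j n w|)).

Let has_sup_psum n w : has_sup (range (fun j => `|psum j n w|)).
Proof.
split; first by exists `|psum 0 n w|, 0%N.
exists (\sum_(i < n) H (w i)) => _ [j _ <-].
by apply: (le_trans (ler_norm_sum _ _ _)); apply: ler_sum => i _; exact: fH.
Qed.

Lemma psum_le_sup j n w : `|psum j n w| <= sup_psum n w.
Proof. by apply: sup_upper_bound => //; exists j. Qed.

Lemma sup_psum_le n w t : (forall j, `|psum j n w| <= t) -> sup_psum n w <= t.
Proof.
move=> h; apply: ge_sup; first by exists `|psum 0 n w|, 0%N.
by move=> _ [j _ <-].
Qed.

Lemma psumD j a b w : psum j (a + b) w = psum j a w + psum j b (seq_shift a w).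
Proof. by rewrite /psum big_split_ord. Qed.

Lemma sup_psum0 w : sup_psum 0 w = 0.
Proof.
apply/eqP; rewrite eq_le; apply/andP; split.
  by apply: sup_psum_le => j; rewrite /psum big_ord0 normr0.
exact: le_trans (psum_le_sup 0 0 w).
Qed.

Lemma measurable_psum j n : measurable_fun setT (psum j n).
Proof.
apply: measurable_sum => i.
by apply: (measurableT_comp (mf j)); exact: measurable_coord.
Qed.

Lemma measurable_sup_psum n : measurable_fun setT (sup_psum n).
Proof.
move=> mD; apply: (measurability _ (RGenOInfty.measurableE R)) => //.
move=> _ [_ [t ->] <-]; rewrite setTI.
have -> : sup_psum n @^-1` `]t, +oo[%classic =
    \bigcup_j (setT `&` (fun w => `|psum j n w|) @^-1` `]t, +oo[%classic).
  apply/seteqP; split => w /=; rewrite in_itv /= andbT.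
    move=> h; apply: contrapT => no; move: h; rewrite ltNge => /negP; apply.
    apply: sup_psum_le => j; rewrite leNgt; apply/negP => h; apply: no.
    by exists j => //; split => //=; rewrite in_itv /= andbT.
  by move=> [j _ [_ /=]]; rewrite in_itv /= andbT => h; exact: lt_le_trans (psum_le_sup j n w).
apply: bigcupT_measurable => j.
have : measurable_fun setT (fun w => `|psum j n w|).
  exact: (measurableT_comp (@normr_measurable R setT) (measurable_psum j n)).
by apply => //; exact: measurable_itv.
Qed.

Lemma dep_sup_psum n (w w' : Seq Z) : (forall i, (i < n)%N -> w i = w' i) ->
  sup_psum n w = sup_psum n w'.
Proof.
move=> ww; rewrite /sup_psum (_ : (fun j => `|psum j n w|) = (fun j => `|psum j n w'|)) //.
apply/funext => j; congr `|_|; apply: eq_bigr => i _; by rewrite ww.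
Qed.

Lemma sup_psumD a b w : sup_psum (a + b) w <= sup_psum a w + sup_psum b (seq_shift a w).
Proof.
apply: sup_psum_le => j; rewrite psumD (le_trans (ler_normD _ _)) //.
by rewrite lerD // psum_le_sup.
Qed.

Lemma sup_psumDl a b w : sup_psum a w <= sup_psum (a + b) w + sup_psum b (seq_shift a w).
Proof.
apply: sup_psum_le => j.
have := psumD j a b w => /(congr1 (fun x => x - psum j b (seq_shift a w))).
rewrite addrK => <-; rewrite (le_trans (ler_normB _ _)) //.
by rewrite lerD // psum_le_sup.
Qed.

Lemma sup_psumDr a b w : sup_psum b (seq_shift a w) <= sup_psum a w + sup_psum (a + b) w.
Proof.
apply: sup_psum_le => j.
have := psumD j a b w => /(congr1 (fun x => x - psum j a w)).
rewrite addrAC subrr add0r => <-; rewrite (le_trans (ler_normB _ _)) // addrC.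
by rewrite lerD // psum_le_sup.
Qed.

Lemma sup_psum1_le w : sup_psum 1 w <= H (w 0%N).
Proof. by apply: sup_psum_le => j; rewrite /psum big_ord1 fH. Qed.

End SupProcess.

Section Tail.
Context {Z : ptopologicalType} {R : realType}.
Local Notation ZB := (Borel Z).
Variables (mu : {measure set ZB -> \bar R}) (q : ZB -> R) (P : probability (Seq Z) R).
Hypothesis dq : is_density mu q.
Hypothesis iid : iid_law mu q P.

Lemma dmeas_ge0 A : (0 <= dmeas mu q A)%E.
Proof.
case: dq => mq q0 _; apply: integral_ge0 => z _; rewrite lee_fin; exact: q0.
Qed.

Lemma dmeas_le1 A : measurable A -> (dmeas mu q A <= 1)%E.
Proof.
case: dq => mq q0 <- mA; apply: ge0_subset_integral => //.
- by apply/measurable_EFinP.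
- by move=> z _; rewrite lee_fin.
Qed.

Lemma dmeasE A : measurable A -> dmeas mu q A = (fine (dmeas mu q A))%:E.
Proof.
move=> mA; rewrite fineK // ge0_fin_numE ?dmeas_ge0 //.
by rewrite (le_lt_trans (dmeas_le1 mA)) ?ltry.
Qed.

Lemma prob_coord0 (A : set ZB) : measurable A -> prob P [set w : Seq Z | A (w 0%N)] = fine (dmeas mu q A).
Proof.
move=> mA; have := iid 1 (A := fun=> A) (fun=> mA).
rewrite big_ord1 => Pe; have -> : fine (dmeas mu q A) = fine (fine (dmeas mu q A))%:E by [].
rewrite -Pe /prob; congr (fine (P _)).
by apply/seteqP; split => w /=; [move=> h [|]|exact].
Qed.

Lemma measurable_L1_dens F : (forall z, 0 < q z) -> L1_dens mu q F ->
  measurable_fun setT F.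
Proof.
move=> q0 /measurable_int /measurable_EFinP mFq.
case: dq => mq _ _.
have -> : F = (fun z => (F z * q z) * expR (- ln (q z))).
  by apply/funext => z; rewrite expRN lnK ?posrE // mulfK // gt_eqF.
apply: measurable_funM => //.
apply: (measurableT_comp (@measurable_expR R)); apply/measurable_funN.
exact: (measurableT_comp (@measurable_ln R)).
Qed.

Variable F : ZB -> R.
Hypothesis F0 : forall z, 0 <= F z.
Hypothesis mF : measurable_fun setT F.
Hypothesis phiF : L1_dens mu q (fun z => phiLL (F z)).

Lemma sum_dmeas_le (c s : R) n : 0 <= c -> 0 < s <= 1 ->
  \sum_(k < n) (2 ^ k * blog k)%N%:R *
     fine (dmeas mu q [set z | s * hpow k * (blog k)%:R < F z + c]) <=
  16 * (Edens mu q (fun z => phiLL (F z)) + phiLL c) / s ^+ 2.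
Proof.
move=> c0 s01; have /andP[s0 s1] := s01.
have [mq q0 q1] := dq.
pose B k : set ZB := [set z | s * hpow k * (blog k)%:R < F z + c].
have mB k : measurable (B k).
  by apply: measurable_fun_gt; exact: measurable_funD.
pose a k : R := (2 ^ k * blog k)%N%:R.
have phiE : (\int[mu]_z (phiLL (F z) * q z)%:E = (Edens mu q (fun z => phiLL (F z)))%:E)%E.
  by rewrite /Edens fineK //; exact: integrable_fin_num.
pose g z := 16 / s ^+ 2 * (phiLL (F z) * q z + phiLL c * q z).
have c16 : 0 <= 16 / s ^+ 2 by rewrite divr_ge0 // exprn_ge0 // ltW.
have ig : (\int[mu]_z (g z)%:E =
    (16 * (Edens mu q (fun z => phiLL (F z)) + phiLL c) / s ^+ 2)%:E)%E.
  rewrite /g; under eq_integral do rewrite EFinM EFinD.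
  have mphi : measurable_fun setT (fun z => (phiLL (F z) * q z)%:E) := measurable_int _ phiF.
  have mc : measurable_fun setT (fun z => (phiLL c * q z)%:E).
    by apply/measurable_EFinP; exact: measurable_funM.
  rewrite ge0_integralZl_EFin //; last 2 first.
  - by move=> z _; rewrite adde_ge0 // lee_fin mulr_ge0 ?phiLL_ge0.
  - exact: emeasurable_funD.
  rewrite ge0_integralD //; last 2 first.
  - by move=> z _; rewrite lee_fin mulr_ge0 ?phiLL_ge0.
  - by move=> z _; rewrite lee_fin mulr_ge0 ?phiLL_ge0.
  rewrite phiE; under [X in (_ + X)%E]eq_integral do rewrite EFinM.
  rewrite ge0_integralZl_EFin ?phiLL_ge0 //; last 2 first.
  - by move=> z _; rewrite lee_fin.
  - exact/measurable_EFinP.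
  by rewrite q1 mule1 -EFinD -EFinM; congr _%:E; ring.
rewrite -lee_fin -ig -sumEFin.
have mt k : measurable_fun setT (fun z => (a k * (q z * \1_(B k) z))%:E).
  apply/measurable_EFinP; by apply: measurable_funM => //; exact: measurable_funM.
have t0 k z : (0 <= (a k * (q z * \1_(B k) z))%:E)%E.
  by rewrite lee_fin !mulr_ge0.
have -> : (\sum_(k < n) ((2 ^ k * blog k)%:R * fine (dmeas mu q (B k)))%:E =
    \int[mu]_z (\sum_(k < n) (a k * (q z * \1_(B k) z))%:E))%E.
  rewrite ge0_integral_sum //; apply: eq_bigr => k _.
  under eq_integral do rewrite EFinM.
  rewrite ge0_integralZl_EFin //; last 2 first.
  - by move=> z _; rewrite lee_fin mulr_ge0.
  - apply/measurable_EFinP; exact: measurable_funM.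
  rewrite EFinM -dmeasE //; congr (_ * _)%E.
  rewrite /dmeas [LHS]integral_mkcond; apply: eq_integral => z _.
  by rewrite patchE indicE; case: ifP => _; rewrite ?mulr1 ?mulr0.
apply: ge0_le_integral => //.
- by move=> z _; apply: sume_ge0.
- exact: emeasurable_sum.
- apply/measurable_EFinP; apply: measurable_funM => //; apply: measurable_funD.
    by apply/measurable_EFinP; exact: (measurable_int _ phiF).
  exact: measurable_funM.
move=> z _; rewrite sumEFin lee_fin.
have Fs0 : 0 <= (F z + c) / s by rewrite divr_ge0 ?addr_ge0 // ltW.
apply: (@le_trans _ _ (q z * (4 * phiLL ((F z + c) / s)))).
  apply: le_trans (ler_wpM2l (q0 z) (sum_dyadic_indic_le n Fs0)).
  rewrite mulr_sumr; apply: ler_sum => k _; rewrite mulrCA ler_wpM2l // ler_wpM2l //.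
  rewrite indicE ler_nat; case: (boolP (z \in B k)) => //; rewrite inE /B /= => h.
  by rewrite ltr_pdivlMr // mulrC mulrA h.
rewrite /g -mulrDl [leRHS]mulrA [leRHS]mulrC ler_wpM2l //.
have h1 := phiLL_div_le (addr_ge0 (F0 z) c0) s01.
have h2 := phiLLD_le (F0 z) c0.
apply: (le_trans (ler_wpM2l _ h1)) => //.
rewrite mulrA [leRHS]mulrAC ler_wpM2r ?invr_ge0 ?exprn_ge0 ?(ltW s0) //; lra.
Qed.

Lemma sum_tail_le (c : R) (D1 : Seq Z -> R) : 0 <= c -> measurable_fun setT D1 ->
  (forall w : Seq Z, D1 w <= F (w 0%N) + c) ->
  forall s : R, 0 < s <= 1 -> forall n,
  \sum_(k < n) (2 ^ k * blog k)%N%:R * prob P [set w | s * hpow k * (blog k)%:R < D1 w]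
  <= 16 * (Edens mu q (fun z => phiLL (F z)) + phiLL c) / s ^+ 2.
Proof.
move=> c0 mD1 D1F s s01 n; apply: le_trans (sum_dmeas_le n c0 s01).
apply: ler_sum => k _; rewrite ler_wpM2l //.
set x := s * _ * _.
have mB : measurable [set z | x < F z + c].
  by apply: measurable_fun_gt; exact: measurable_funD.
rewrite -prob_coord0 //; apply: le_prob.
- exact: measurable_fun_gt.
- have -> : [set w : Seq Z | x < F (w 0%N) + c] =
    setT `&` (fun w : Seq Z => w 0%N : ZB) @^-1` [set z | x < F z + c] by rewrite setTI.
  exact: measurable_coord.
- by move=> w /= h; exact: lt_le_trans (D1F w).
Qed.

End Tail.

(** * Tightness from the Donsker property *)

Lemma prob_gt_small d (T : measurableType d) (R : realType) (P : probability T R)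
    (X : T -> R) (e : R) : measurable_fun setT X -> 0 < e ->
  exists2 m, 0 <= m & prob P [set w | m < X w] <= e.
Proof.
move=> mX e0; pose A (i : nat) := [set w | i%:R < X w].
have mA i : measurable (A i) by exact: measurable_fun_gt.
have A0 : \bigcap_i A i = set0.
  apply/seteqP; split => // w Aw.
  have [x0|x0] := leP 0 (X w); last by have := Aw 0%N I; rewrite /A /= ltNge ltW.
  have := Aw (Num.truncn (X w)).+1 I; rewrite /A /= ltNge => /negP; apply.
  by have /andP[_ /ltW] := truncn_itv x0.
have : P (A i) @[i --> \oo] --> P (\bigcap_i A i).
  apply: nonincreasing_cvg_mu => //.
  - by apply: le_lt_trans (probability_le1 P (mA 0%N)) _; exact: ltry.
  - exact: bigcapT_measurable.
  - move=> i j ij; apply/subsetPset => w; rewrite /A /=; apply: le_lt_trans.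
    by rewrite ler_nat.
rewrite A0 measure0 => /fine_cvgP [_] /cvgrPdist_le /(_ e e0) [i _ /(_ i (leqnn i))].
rewrite /= sub0r normrN => h; exists i%:R => //.
by apply: le_trans h; rewrite /prob ler_norm.
Qed.

Section Supdist.
Context {Z : ptopologicalType} {R : realType} (F : set (Z -> R)).
Hypothesis F0 : F !=set0.
Implicit Types x y : (Z -> R) -> R.
Let zero : (Z -> R) -> R := fun=> 0.

Lemma linf0 : linf F zero.
Proof. by exists 0 => g _; rewrite normr0. Qed.

Lemma has_sup_supdist x y : linf F x -> linf F y -> has_sup [set `|x g - y g| | g in F].
Proof.
move=> [M hM] [N hN]; split; first by have [g Fg] := F0; exists `|x g - y g|, g.
exists (M + N) => _ [g Fg <-].
by rewrite (le_trans (ler_normB _ _)) // lerD ?hM ?hN.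
Qed.

Lemma supdist_ge x y g : linf F x -> linf F y -> F g -> `|x g - y g| <= supdist F x y.
Proof. by move=> lx ly Fg; apply: sup_upper_bound; [exact: has_sup_supdist|exists g]. Qed.

Lemma supdist_le x y t : (forall g, F g -> `|x g - y g| <= t) -> supdist F x y <= t.
Proof.
move=> h; apply: ge_sup => [|_ [g Fg <-]]; last exact: h.
by have [g Fg] := F0; exists `|x g - y g|, g.
Qed.

Lemma supdist0_lip x y : linf F x -> linf F y ->
  supdist F y zero <= supdist F x zero + supdist F x y.
Proof.
move=> lx ly; apply: supdist_le => g Fg.
have := supdist_ge lx linf0 Fg; have := supdist_ge lx ly Fg.
rewrite /zero !subr0 => h1 h2.
have : `|y g| <= `|x g| + `|x g - y g|.
  by rewrite -{1}(subKr (x g) (y g)) ler_normB.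
lra.
Qed.

Lemma supdistC x y : supdist F x y = supdist F y x.
Proof.
by rewrite /supdist; congr sup; apply/seteqP; split => _ [g Fg <-]; exists g => //;
  rewrite distrC.
Qed.

Definition clamp_norm (M : R) x : R := Num.min 1 (Num.max 0 (supdist F x zero - M)).

Lemma clamp_norm_ge0 M x : 0 <= clamp_norm M x.
Proof. by rewrite /clamp_norm le_min ler01 le_max lexx. Qed.

Lemma clamp_norm_le1 M x : clamp_norm M x <= 1.
Proof. by rewrite /clamp_norm ge_min lexx. Qed.

Lemma clamp_norm_bcont M : linf_bcont F (clamp_norm M).
Proof.
split.
  by exists 1 => x _; rewrite ger0_norm ?clamp_norm_ge0 // clamp_norm_le1.
move=> x lx e e0; exists e => // y ly xy.
have h1 := supdist0_lip lx ly; have h2 := supdist0_lip ly lx.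
rewrite (supdistC y x) in h2.
apply: le_lt_trans xy; move: h1 h2; rewrite /clamp_norm.
move: (supdist F x zero) (supdist F y zero) (supdist F x y) => a b c h1 h2.
have step : forall u v r : R, 0 <= r -> u <= v + r ->
    Num.min 1 (Num.max 0 u) <= Num.min 1 (Num.max 0 v) + r.
  move=> u v r r0 uv; rewrite addr_minl le_min; apply/andP; split.
    by rewrite ge_min lerDl r0.
  by rewrite ge_min addr_maxl add0r ge_max !le_max r0 uv orbT orbT.
have c0 : 0 <= c by lra.
have := step (a - M) (b - M) c c0; have := step (b - M) (a - M) c c0.
move=> s1 s2; rewrite ler_norml; apply/andP; split.
  by rewrite lerBrDr addrC lerBlDr s2 //; lra.
by rewrite lerBlDl s1 //; lra.
Qed.

Lemma clamp_norm_eq1 M x : M + 1 <= supdist F x zero -> clamp_norm M x = 1.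
Proof.
by move=> h; rewrite /clamp_norm; apply/min_idPl; rewrite le_max; apply/orP; right; lra.
Qed.

Lemma clamp_norm_eq0 M x : supdist F x zero <= M -> clamp_norm M x = 0.
Proof.
move=> h; rewrite /clamp_norm max_l ?min_r //; lra.
Qed.

Lemma open_ball0 t : linf_open F [set x | linf F x /\ supdist F x zero < t].
Proof.
split => [x []//|x [lx xt]]; exists (t - supdist F x zero); first by rewrite subr_gt0.
move=> y ly xy; split => //; have := supdist0_lip lx ly; lra.
Qed.

End Supdist.

Section DonskerTight.
Context {Z : ptopologicalType} {R : realType}.
Local Notation ZB := (Borel Z).
Variables (mu : {measure set ZB -> \bar R}) (q : ZB -> R) (P : probability (Seq Z) R).
Variables (F : set (Z -> R)) (g : nat -> ZB -> R) (H : ZB -> R).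
Hypothesis gF : forall j, F (g j).
Hypothesis mg : forall j, measurable_fun setT (g j).
Let f j z := g j z - Edens mu q (g j).
Hypothesis fH : forall j z, `|f j z| <= H z.
Hypothesis FD : donsker mu F q P.

Let F0 : F !=set0. Proof. by exists (g 0%N). Qed.
Let zero : (Z -> R) -> R := fun=> 0.

Let mf j : measurable_fun setT (f j).
Proof. exact: measurable_funB. Qed.

Lemma sup_psum_le_supdist n w :
  sup_psum f n w <= Num.sqrt n%:R * supdist F (emp_proc mu q n w) zero.
Proof.
apply: sup_psum_le => // j.
case: n => [|n]; first by rewrite /psum big_ord0 normr0 sqrtr0 mul0r.
have s0 : 0 < Num.sqrt n.+1%:R :> R by rewrite sqrtr_gt0.
have := supdist_ge F0 (FD.1 n.+1 w) (linf0 F) (gF j).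
rewrite subr0 /emp_proc normrM (gtr0_norm s0) => h.
apply: le_trans (ler_wpM2l (ltW s0) h); rewrite mulrA -expr2 sqr_sqrtr //.
rewrite -[X in X * _](@gtr0_norm _ n.+1%:R) // -normrM mulrBr mulrA divff // mul1r.
by rewrite /psum /f big_split /= sumr_const card_ord mulr_natl mulNrn.
Qed.

(* Test the weak convergence on the norm truncated to [0, 1] beyond a level that the limit
   rarely exceeds. *)
Lemma emp_proc_tight e : 0 < e -> exists2 M, 0 < M & \forall n \near \oo,
  prob P [set w | M * Num.sqrt n%:R < sup_psum f n w] <= e.
Proof.
move=> e0; have [linfE [disp [OT [PG [G [lG mG _ _ cvgG]]]]]] := FD.
have mX : measurable_fun setT (fun o => supdist F (G o) zero).
  move=> mD; apply: (measurability _ (RGenInftyO.measurableE R)) => //.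
  move=> _ [_ [t ->] <-]; rewrite setTI.
  rewrite [X in measurable X](_ : _ = G @^-1` [set x | linf F x /\ supdist F x zero < t]).
    exact/mG/(open_ball0 F0).
  by apply/seteqP; split => o /=; rewrite in_itv /=; [split|case].
have [m m0 hm] := prob_gt_small PG mX (divr_gt0 e0 (ltr0n R 2)).
have mh : measurable_fun setT (fun o => clamp_norm F m (G o)).
  apply: measurable_minr => //; apply: measurable_maxr => //.
  exact: measurable_funB.
have inth : (\int[PG]_o (clamp_norm F m (G o))%:E <= (e / 2)%:E)%E.
  apply: (@le_trans _ _ (\int[PG]_o (\1_[set o | m < supdist F (G o) zero] o)%:E)%E).
    apply: ge0_le_integral => //.
    - by move=> o _; rewrite lee_fin clamp_norm_ge0.
    - exact/measurable_EFinP.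
    - apply/measurable_EFinP/measurable_indic; exact: measurable_fun_gt.
    - move=> o _; rewrite lee_fin indicE.
      case: (boolP (o \in _)) => [_|]; first exact: clamp_norm_le1.
      by rewrite notin_setE /= => /negP; rewrite -leNgt => /clamp_norm_eq0 ->.
  rewrite integral_indic ?setIT //; last exact: measurable_fun_gt.
  by move: hm; rewrite -lee_fin -probE //; exact: measurable_fun_gt.
exists (m + 1); first lra.
have lt_e : (\int[PG]_o (clamp_norm F m (G o))%:E < e%:E)%E.
  by apply: (le_lt_trans inth); rewrite lte_fin; lra.
have /cvgG := clamp_norm_bcont F0 m.
move=> /(_ [set x | (x < e%:E)%E]) h.
have : \forall n \near \oo, (outer_E P (fun w => clamp_norm F m (emp_proc mu q n w)) < e%:E)%E.
  apply: h; apply: open_nbhs_nbhs; split => //; exact: open_ereal_lt_ereal.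
apply: filterS => n /ereal_inf_lt [_ [U [mU iU hU] <-] Ue].
have mD := measurable_sup_psum mf fH n.
have mA : measurable [set w | (m + 1) * Num.sqrt n%:R < sup_psum f n w].
  exact: measurable_fun_gt.
rewrite -lee_fin -probE //; apply: (le_trans _ (ltW Ue)).
rewrite -[X in P X]setIT -integral_indic //.
apply: ge0_le_integral => //.
- exact/measurable_EFinP/measurable_indic.
- exact/measurable_EFinP.
- move=> w _; rewrite lee_fin indicE; apply: le_trans (hU w).
  case: (boolP (w \in _)) => [|_]; last exact: clamp_norm_ge0.
  rewrite inE /= => h1; rewrite clamp_norm_eq1 //.
  have := lt_le_trans h1 (sup_psum_le_supdist n w); rewrite mulrC.
  case: (posnP n) => [->|n0]; first by rewrite sqrtr0 !mul0r ltxx.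
  by rewrite ltr_pM2l ?sqrtr_gt0 ?ltr0n // => /ltW.
Qed.

Lemma donsker_tight e : 0 < e -> exists2 M, 0 < M & forall n,
  prob P [set w | M * Num.sqrt n%:R < sup_psum f n w] <= e.
Proof.
move=> e0; have [M M0 [N _ hN]] := emp_proc_tight e0.
have mD n : measurable_fun setT (sup_psum f n) := measurable_sup_psum mf fH n.
have /choice [m hm] n : exists m, 0 <= m /\ prob P [set w | m < sup_psum f n w] <= e.
  by have [m m0 hm] := prob_gt_small P (mD n) e0; exists m.
exists (M + \sum_(i < N) m i) => [|n].
  by rewrite ltr_wpDr // sumr_ge0 // => i _; exact: (hm i).1.
have s0 : 0 <= \sum_(i < N) m i by rewrite sumr_ge0 // => i _; exact: (hm i).1.
have [Nn|nN] := leqP N n.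
  apply: le_trans (hN n Nn); apply: le_prob; try exact: measurable_fun_gt.
  move=> w /=; apply: le_lt_trans; rewrite ler_wpM2r //; lra.
case: n nN => [|n] nN.
  rewrite (_ : [set w | _] = set0) ?prob0 ?(ltW e0) //.
  by apply/seteqP; split => // w /=; rewrite (sup_psum0 fH) sqrtr0 mulr0 ltxx.
apply: le_trans (hm n.+1).2; apply: le_prob; try exact: measurable_fun_gt.
move=> w /=; apply: le_lt_trans.
have mle : m n.+1 <= \sum_(i < N) m i.
  by rewrite (bigD1 (Ordinal nN)) //= lerDl sumr_ge0 // => i _; exact: (hm i).1.
have r1 : 1 <= Num.sqrt n.+1%:R :> R by rewrite -[leLHS]sqrtr1 ler_wsqrtr // ler1n.
have := (hm n.+1).1; nra.
Qed.

End DonskerTight.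

(** * Rates and dense sequences *)

Section Rate.
Context {R : realType}.

Definition lil_rate (n : nat) : R := Num.sqrt (n%:R * ln (ln n%:R)).

Lemma ln2_ge_half : 1 / 2 <= ln 2 :> R.
Proof.
have := expR_ge1Dx (- ln 2 : R); rewrite expRN lnK ?posrE //; lra.
Qed.

Lemma blog_le_lnln k n : (8 <= k)%N -> (2 ^ k <= n)%N ->
  (blog k.+1)%:R <= 8 * ln (ln n%:R) :> R.
Proof.
move=> k8 kn; have h2 := ln2_ge_half.
have k8R : 8 <= k%:R :> R by rewrite (ler_nat _ 8).
have lnn : k%:R / 2 <= ln n%:R :> R.
  have : ln (2 ^+ k) <= ln n%:R :> R.
    rewrite ler_ln ?posrE ?exprn_gt0 // -?natrX ?ler_nat //.
    by rewrite ltr0n (leq_trans _ kn) // expn_gt0.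
  by rewrite lnXn // -[ln 2 *+ k]mulr_natr; nra.
have lnln : ln (k%:R / 2) <= ln (ln n%:R) :> R by rewrite ler_ln ?posrE //; lra.
have lnk : ln k.+2%:R <= 2 * ln (k%:R / 2) :> R.
  rewrite mulr_natl -lnXn; last by lra.
  rewrite ler_ln ?posrE //; last by rewrite exprn_gt0 //; lra.
  have -> : k.+2%:R = k%:R + 2 :> R by rewrite -addn2 natrD.
  by nra.
have bl : (blog k.+1).-1%:R * ln 2 <= ln k.+2%:R :> R.
  rewrite mulr_natl -lnXn // ler_ln ?posrE ?exprn_gt0 //.
  by rewrite -natrX ler_nat pow_blog_le.
have b2 : 1 <= (blog k.+1).-1%:R :> R.
  by rewrite ler1n /blog /= trunc_log_gt0.
have : (blog k.+1)%:R = (blog k.+1).-1%:R + 1 :> R by rewrite natr1 prednK.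
nra.
Qed.

Lemma blogS_le k : (blog k.+1 <= 2 * blog k)%N.
Proof.
have h : (trunc_log 2 k.+2 <= (trunc_log 2 k.+1).+1)%N.
  rewrite -ltnS -(ltn_exp2l (m := 2)) //.
  apply: (leq_ltn_trans (trunc_logP _ _)) => //.
  by have := pow_blog_gt k; rewrite /blog !expnS; lia.
by rewrite /blog; lia.
Qed.

Lemma lil_rate_dyadic k0 : exists N, forall n, (N <= n)%N -> exists k,
  [/\ (k0 <= k)%N, (n <= 2 ^ k * blog k)%N &
      hpow k * (blog k)%:R <= 6 * lil_rate n].
Proof.
pose k1 := maxn k0 9.
exists (2 ^ k1 * blog k1).+1 => n nN.
have ex : exists k, (n <= 2 ^ k * blog k)%N.
  by exists n; rewrite (leq_trans (ltnW (ltn_expl n (ltnSn 1)))) // leq_pmulr.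
case: (ex_minnP ex) => k nk kmin.
have mono i j : (i <= j)%N -> (2 ^ i * blog i <= 2 ^ j * blog j)%N.
  by move=> ij; rewrite leq_mul ?leq_exp2l ?leq_blog.
have k1k : (k1 < k)%N.
  by rewrite ltnNge; apply/negP => /mono h; move: nN; rewrite ltnNge (leq_trans nk).
exists k; split => //; first by rewrite (leq_trans (leq_maxl k0 9)) // ltnW.
have k9 : (9 <= k.-1)%N by move: k1k; rewrite /k1; lia.
case: k => // k in nk kmin k1k k9 *; rewrite /= in k9.
have kn : (2 ^ k * blog k < n)%N.
  by rewrite ltnNge; apply/negP => /kmin; rewrite ltnn.
have k2n : (2 ^ k <= n)%N by rewrite (leq_trans _ (ltnW kn)) // leq_pmulr.
have L8 := blog_le_lnln (ltnW k9) k2n.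
rewrite /lil_rate; set b : R := (blog k.+1)%:R in L8 *.
have b0 : 0 <= b by [].
have n0 : 0 <= n%:R :> R by [].
have sq : (hpow k.+1 * b) ^+ 2 <= 32 * (n%:R * ln (ln n%:R)).
  rewrite exprMn sqr_hpow expnS natrM.
  have : (2 ^ k)%N%:R * b <= 2 * n%:R :> R.
    rewrite -!natrM ler_nat; apply: (leq_trans (leq_mul (leqnn _) (blogS_le k))).
    by rewrite mulnCA leq_mul2l ltnW.
  have : 0 <= (2 ^ k)%N%:R :> R by [].
  move: ((2 ^ k)%N%:R) => a a0 h.
  apply: (@le_trans _ _ (4 * (n%:R * b))); first by rewrite expr2; nra.
  by rewrite mulrCA [32 * _]mulrCA ler_wpM2l //; lra.
have h0 : 0 <= hpow k.+1 * b by rewrite mulr_ge0 // ltW // hpow_gt0.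
rewrite -(ler_pXn2r (n := 2)) // ?nnegrE ?mulr_ge0 //.
apply: (le_trans sq); rewrite exprMn sqr_sqrtr.
  by rewrite ler_wpM2r //; [rewrite mulr_ge0 //|]; lra.
by rewrite mulr_ge0 //; lra.
Qed.

End Rate.

Lemma compact_finite_net (R : realType) (T : pseudoMetricType R) (A : set T) (e : R) :
  compact A -> 0 < e -> exists D : seq T, forall x, A x ->
    exists z, [/\ z \in D, A z & ball z e x].
Proof.
move=> /compact_near_coveringP cA e0.
pose F : set_system (seq T) := [set V | exists D0 : seq T, forall D : seq T, {subset D0 <= D} -> V D].
have FF : Filter F.
  split; first by exists [::].
    move=> V W [D0 h0] [D1 h1]; exists (D0 ++ D1) => D sD.
    by split; [apply: h0|apply: h1] => z zD; apply: sD; rewrite mem_cat zD ?orbT.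
  by move=> V W VW [D0 h0]; exists D0 => D /h0 /VW.
have [] := cA (seq T) F (fun D x => exists z, [/\ z \in D, A z & ball z e x]) FF.
  move=> x Ax; exists (ball x e, [set D : seq T | x \in D]).
    split; first exact: nbhsx_ballx.
    by exists [:: x] => D; apply; rewrite mem_head.
  by move=> [y D] [/= xy xD]; exists x.
by move=> D h; exists D => x Ax; apply: (h D _ x).
Qed.

Lemma compact_dense_seq (R : realType) (T : pseudoMetricType R) (A : set T) (a : T) :
  compact A -> A a -> exists s : nat -> T, (forall i, A (s i)) /\
    forall x U, A x -> nbhs x U -> exists i, U (s i).
Proof.
move=> cA Aa.
have /choice [D hD] n : exists D : seq T, forall x, A x ->
    exists z, [/\ z \in D, A z & ball z (n.+1%:R^-1 : R) x].
  by apply: compact_finite_net => //; rewrite invr_gt0.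
pose r i := if @choice.unpickle (nat * nat)%type i is Some (n, j) then nth a (D n) j else a.
have /choice [s hs] i : exists t, A t /\ (A (r i) -> t = r i).
  by have [Ar|nAr] := pselect (A (r i)); [exists (r i)|exists a].
exists s; split; first by move=> i; exact: (hs i).1.
move=> x U Ax /nbhs_ballP [e /= e0 eU].
have [n ne] : exists n, n.+1%:R^-1 < e.
  by have [n] := ltr_add_invr (y := 0) e0; rewrite add0r; exists n.
have [z [zD Az zx]] := hD n x Ax.
exists (choice.pickle (n, index z (D n))).
have rz : r (choice.pickle (n, index z (D n))) = z by rewrite /r choice.pickleK nth_index.
rewrite (hs _).2 rz //.
by apply: eU; apply: (le_ball (ltW ne)); exact: ball_sym.
Qed.

(** * Log-likelihood ratios *)

Definition llr (R : realType) (Z : Type) (q r : Z -> R) (z : Z) : R := ln (r z) - ln (q z).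

Section Likelihood.
Context {R : realType} {Z : ptopologicalType}.
Local Notation ZB := (Borel Z).
Variables (mu : {measure set ZB -> \bar R}) (q : ZB -> R) (F : ZB -> R).
Hypothesis dq : is_density mu q.
Hypothesis q0 : forall z, 0 < q z.
Hypothesis LF : L1_dens mu q F.

Lemma integrable_density (r : ZB -> R) : is_density mu r -> mu.-integrable setT (EFin \o r).
Proof.
move=> [mr r0 r1]; apply/integrableP; split; first exact/measurable_EFinP.
rewrite (eq_integral (fun z => (r z)%:E)) ?r1 ?ltry // => z _.
by rewrite /= ger0_norm.
Qed.

Lemma dominated_L1_dens (g : ZB -> R) : measurable_fun setT g -> (forall z, `|g z| <= F z) ->
  L1_dens mu q g.
Proof.
have [mq _ _] := dq => mg gF; apply: le_integrable LF => //.
  by apply/measurable_EFinP; exact: measurable_funM.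
move=> z _; rewrite lee_fin !normrM ler_wpM2r //.
by rewrite (le_trans (gF z)) // ler_norm.
Qed.

Lemma EdensE (g : ZB -> R) : L1_dens mu q g ->
  (\int[mu]_z (g z * q z)%:E = (Edens mu q g)%:E)%E.
Proof. by move=> ig; rewrite /Edens fineK //; exact: integrable_fin_num. Qed.

Lemma normr_Edens_le (g : ZB -> R) : measurable_fun setT g -> (forall z, `|g z| <= F z) ->
  `|Edens mu q g| <= Edens mu q F.
Proof.
move=> mg gF; have ig := dominated_L1_dens mg gF.
rewrite -lee_fin -abse_EFin -!EdensE //.
apply: (le_trans (le_abse_integral _ _ _)) => //; first exact: (measurable_int _ ig).
have [mq _ _] := dq.
apply: ge0_le_integral => //.
- by apply: measurableT_comp => //; exact: (measurable_int _ ig).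
- exact: (measurable_int _ LF).
- move=> z _; rewrite lee_fin normrM (gtr0_norm (q0 z)).
  by rewrite ler_wpM2r ?(ltW (q0 z)).
Qed.

Section OneDensity.
Variable r : ZB -> R.
Hypothesis dr : is_density mu r.
Hypothesis r0 : forall z, 0 < r z.
Hypothesis rF : forall z, `|llr q r z| <= F z.

Lemma measurable_llr : measurable_fun setT (llr q r).
Proof.
have [mq _ _] := dq; have [mr _ _] := dr.
by apply: measurable_funB; apply: (measurableT_comp (@measurable_ln R)).
Qed.

Lemma L1_llr : L1_dens mu q (llr q r).
Proof. by apply: dominated_L1_dens => //; exact: measurable_llr. Qed.

(* Nonnegative since [1 + x <= exp x] at the log-likelihood ratio; its integral is a divergence. *)
Let gap z : R := r z - q z - llr q r z * q z.

Let gap_ge0 z : 0 <= gap z.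
Proof.
have := expR_ge1Dx (llr q r z); rewrite /llr expRD expRN !lnK ?posrE // => h.
have : (1 + (ln (r z) - ln (q z))) * q z <= r z / q z * q z.
  by rewrite ler_wpM2r // ltW.
by rewrite divfK ?gt_eqF // /gap /llr; lra.
Qed.

Let integral_gap : (\int[mu]_z (gap z)%:E = (- Edens mu q (llr q r))%:E)%E.
Proof.
rewrite /gap; under eq_integral do rewrite EFinB EFinB.
have ir := integrable_density dr; have iq := integrable_density dq.
rewrite integralB //; [|exact: integrableB|exact: L1_llr].
rewrite integralB // (EdensE L1_llr).
have [_ _ ->] := dr; have [_ _ ->] := dq.
by rewrite -!EFinB subrr sub0r.
Qed.

Lemma gibbs : Edens mu q (llr q r) <= 0.
Proof.
have : (0 <= \int[mu]_z (gap z)%:E)%E by apply: integral_ge0 => z _; rewrite lee_fin.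
by rewrite integral_gap lee_fin oppr_ge0.
Qed.

Lemma gibbs_eq : Edens mu q (llr q r) = 0 -> same_law mu q r.
Proof.
have [mq _ _] := dq; have [mr _ _] := dr.
move=> E0 A mA; apply: ae_eq_integral => //; try by apply/measurable_EFinP; exact: measurable_funTS.
have mgap : measurable_fun setT (EFin \o gap).
  apply/measurable_EFinP; apply: measurable_funB; first exact: measurable_funB.
  by apply: measurable_funM => //; exact: measurable_llr.
have : ae_eq mu setT (EFin \o gap) (cst 0%E).
  apply/(ae_eq_integral_abs _ measurableT mgap).
  rewrite (eq_integral (fun z => (gap z)%:E)); last first.
    by move=> z _; rewrite /= ger0_norm.
  by rewrite integral_gap E0 oppr0.
apply: filterS => z /(_ I) /= [gz] _; congr _%:E.
have [l0|/expR_gt1Dx] := eqVneq (llr q r z) 0.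
  by move: gz; rewrite /gap l0 mul0r subr0 => /eqP; rewrite subr_eq0 => /eqP ->.
rewrite /llr expRD expRN !lnK ?posrE // => h.
have : (1 + (ln (r z) - ln (q z))) * q z < r z / q z * q z by rewrite ltr_pM2r.
by rewrite divfK ?gt_eqF //; move: gz; rewrite /gap /llr; lra.
Qed.

Lemma same_law_Edens : same_law mu q r -> Edens mu q (llr q r) = 0.
Proof.
have [mq _ _] := dq; have [mr _ _] := dr.
move=> sl; apply: EFin_inj; rewrite -(EdensE L1_llr).
have qr : ae_eq mu setT (EFin \o q) (EFin \o r).
  apply: integral_ae_eq => //; first exact: integrable_density.
    exact/measurable_EFinP.
  by move=> A _ mA; exact: sl.
rewrite (ae_eq_integral (cst 0%E)) ?integral0 //.
- exact: (measurable_int _ L1_llr).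
- by apply: filterS qr => z /(_ I) /= [qz] _; rewrite /llr qz subrr mul0r.
Qed.

Lemma KL_llr : KL mu q r = (- Edens mu q (llr q r))%:E.
Proof.
rewrite /KL.
have -> : [set z | 0 < q z /\ r z <= 0] = set0.
  by apply/seteqP; split => // z /= [_]; rewrite leNgt r0.
rewrite measure0 eqxx.
have -> : [set z | 0 < q z] = setT by apply/seteqP; split => // z _; exact: q0.
rewrite -mulN1r EFinM -(EdensE L1_llr) -integralZl //; last exact: L1_llr.
apply: eq_integral => z _; rewrite -EFinM; congr _%:E.
by rewrite /llr lnM ?posrE ?invr_gt0 // lnV ?posrE //; ring.
Qed.

End OneDensity.

Section Family.
Context {Theta : metricType R}.
Variables (A : set Theta) (p : Theta -> ZB -> R).
Hypothesis cA : compact A.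
Hypothesis dp : forall th, A th -> is_density mu (p th).
Hypothesis p0 : forall th z, A th -> 0 < p th z.
Hypothesis pF : forall th z, A th -> `|llr q (p th) z| <= F z.
Hypothesis cp : forall z, {within A, continuous (fun th => ln (p th z))}.

Lemma Edens_llr_cvg th (s : nat -> Theta) : A th -> (forall i, A (s i)) ->
  s @ \oo --> th ->
  Edens mu q (llr q (p (s i))) @[i --> \oo] --> Edens mu q (llr q (p th)).
Proof.
have [mq _ _] := dq.
move=> Ath As cs.
have ig (t : Theta) : A t -> L1_dens mu q (llr q (p t)).
  by move=> At; apply: L1_llr => [|z]; [exact: dp|exact: pF].
have cvgp z : llr q (p (s i)) z @[i --> \oo] --> llr q (p th) z.
  apply: cvgB; last exact: cvg_cst.
  have /subspace_continuousP/(_ th Ath) h := @cp z.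
  apply: cvg_trans h => U /= /cs [N _ hN]; exists N => // i /hN; exact.
have mfi i : measurable_fun setT (fun z => (llr q (p (s i)) z * q z)%:E).
  exact: (measurable_int _ (ig _ (As i))).
have [] := dominated_convergence (mu := mu) measurableT mfi (f := fun z => (llr q (p th) z * q z)%:E)
    (g := fun z => (F z * q z)%:E).
- exact: (measurable_int _ (ig _ Ath)).
- apply: aeW => z _; apply: cvg_EFin; first by apply: nearW => i.
  by apply: cvgM => //; exact: cvg_cst.
- exact: LF.
- apply: aeW => z i _; rewrite lee_fin normrM (gtr0_norm (q0 z)).
  by rewrite ler_wpM2r ?(ltW (q0 z)) // pF.
move=> _ _; rewrite (EdensE (ig _ Ath)).
rewrite (_ : (fun i => \int[mu]_z _)%E = (fun i => (Edens mu q (llr q (p (s i))))%:E)).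
  by move=> /fine_cvgP [].
by apply/funext => i; rewrite (EdensE (ig _ (As i))).
Qed.

Lemma Edens_llr_gap : (forall th, A th -> ~ same_law mu q (p th)) ->
  exists2 delta, 0 < delta & forall th, A th -> Edens mu q (llr q (p th)) <= - delta.
Proof.
move=> nsl.
pose E (t : Theta) := Edens mu q (llr q (p t)).
have E0 t : A t -> E t < 0.
  move=> At; rewrite lt_neqAle; apply/andP; split; last first.
    by apply: gibbs => [|z|z]; [exact: dp|exact: p0|exact: pF].
  apply/eqP => Et0; apply: (nsl t At).
  by apply: gibbs_eq Et0 => [|z|z]; [exact: dp|exact: p0|exact: pF].
have /compact_near_coveringP nA := cA.
have [] := nA nat \oo (fun j t => A t -> E t <= - j.+1%:R^-1) _; last first.
  move=> N _ /(_ N (leqnn N)) h; exists N.+1%:R^-1; first by rewrite invr_gt0.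
  by move=> t At; exact: (h t At At).
move=> th Ath.
have loc : exists j : nat, forall t, ball th (j.+1%:R^-1 : R) t -> A t -> E t <= - j.+1%:R^-1.
  apply: contrapT => /forallNP no.
  have /choice [s hs] j : exists t, [/\ ball th (j.+1%:R^-1 : R) t, A t & - j.+1%:R^-1 < E t].
    have /existsNP [t] := no j.
    by move=> /not_implyP [bt /not_implyP [At /negP]]; rewrite -ltNge => Et; exists t.
  have cs : s @ \oo --> th.
    apply/cvg_ballP => e e0.
    have [n ne] := ltr_add_invr (y := 0) e0; rewrite add0r in ne.
    exists n => // i /= ni; have [bi _ _] := hs i; apply: le_ball bi.
    apply: le_trans (ltW ne); rewrite lef_pV2 ?posrE // ler_nat.
    by rewrite ltnS.
  have cE := Edens_llr_cvg Ath (fun j => let: And3 _ a _ := hs j in a) cs.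
  have : 0 <= E th.
    have hN : - (@harmonic R j) @[j --> \oo] --> - 0 by apply: cvgN; exact: cvg_harmonic.
    rewrite -oppr0; apply: (ler_cvg_to hN cE); apply: nearW => j.
    by have [_ _ /ltW] := hs j.
  by rewrite leNgt E0.
have [j hj] := loc.
exists (ball th (j.+1%:R^-1 : R), [set i | (j <= i)%N]).
  by split; [apply: nbhsx_ballx; rewrite invr_gt0|exists j].
move=> [t i] [/= bt ji] At; apply: (le_trans (hj t bt At)).
by rewrite lerN2 lef_pV2 ?posrE // ler_nat ltnS.
Qed.

End Family.

End Likelihood.

Section UniformLIL.
Context {R : realType} {Z : ptopologicalType} {Theta : Type}.
Local Notation ZB := (Borel Z).
Variables (mu : {measure set ZB -> \bar R}) (q : ZB -> R) (P : probability (Seq Z) R).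
Variables (A : set Theta) (p : Theta -> ZB -> R) (F : ZB -> R).
Hypothesis dq : is_density mu q.
Hypothesis q0 : forall z, 0 < q z.
Hypothesis iid : iid_law mu q P.
Hypothesis dp : forall th, A th -> is_density mu (p th).
Hypothesis pF : forall th z, A th -> `|llr q (p th) z| <= F z.
Hypothesis F0 : forall z, 0 <= F z.
Hypothesis LF : L1_dens mu q F.
Hypothesis phiF : L1_dens mu q (fun z => phiLL (F z)).
Hypothesis FD : donsker mu [set (fun z => ln (p th z) - ln (q z)) | th in A] q P.

Local Notation E th := (Edens mu q (llr q (p th))).

Lemma seq_lil (t : nat -> Theta) : (forall j, A (t j)) -> exists2 C, 0 < C &
  {ae P, forall w : Seq Z, exists N, forall n j, (N <= n)%N ->
    `|\sum_(i < n) llr q (p (t j)) (w i) - n%:R * E (t j)| <= C * lil_rate n}.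
Proof.
move=> At.
pose f j z := llr q (p (t j)) z - E (t j).
have mt j : measurable_fun setT (llr q (p (t j))).
  exact: (measurable_llr dq (dp (At j))).
have mf j : measurable_fun setT (f j) by exact: measurable_funB.
pose c := Edens mu q F.
have Ec j : `|E (t j)| <= c.
  by apply: normr_Edens_le => // z; exact: pF.
have c0 : 0 <= c := le_trans (normr_ge0 _) (Ec 0%N).
have fH j z : `|f j z| <= F z + c.
  by rewrite (le_trans (ler_normB _ _)) // lerD // pF.
have Pind : forall k (B C : set (Seq Z)), dep k B -> measurable B -> measurable C ->
    P (B `&` seq_shift k @^-1` C) = (P B * P C)%E.
  by apply: (indep_shift (q := fun B => fine (dmeas mu q B))); exact: iid.
have mF := measurable_L1_dens dq q0 LF.
have mD := measurable_sup_psum mf fH.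
have tight : forall e : R, 0 < e -> exists2 M, 0 < M &
    forall n, prob P [set w | M * Num.sqrt n%:R < sup_psum f n w] <= e.
  apply: (donsker_tight (g := fun j => llr q (p (t j))) _ mt fH FD).
  by move=> j; exists (t j).
have tail := sum_tail_le dq iid F0 mF phiF c0 (mD 1%N) (sup_psum1_le fH).
have [C C0 aeC] := bounded_lil Pind (sup_psum0 fH) mD (@dep_sup_psum _ _ f) (sup_psumD fH)
  (sup_psumDl fH) (sup_psumDr fH) tight tail.
exists (C * 6); first by rewrite mulr_gt0.
apply: filterS aeC => w [k0 hw].
have [N hN] := lil_rate_dyadic (R := R) k0.
exists N => n j Nn; have [k [k0k nk hk]] := hN n Nn.
have -> : \sum_(i < n) llr q (p (t j)) (w i) - n%:R * E (t j) = psum f j n w.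
  by rewrite /psum /f [RHS]big_split sumr_const card_ord mulr_natl mulNrn.
apply: (le_trans (psum_le_sup fH j n w)); apply: (le_trans (hw k n k0k nk)).
by rewrite -mulrA ler_wpM2l // ltW.
Qed.

End UniformLIL.

Section Core.
Context {R : realType} {Z : ptopologicalType} {Theta : metricType R}.
Local Notation ZB := (Borel Z).
Variables (mu : {measure set ZB -> \bar R}) (q : ZB -> R) (P : probability (Seq Z) R).
Variables (ThetaK : nat -> set Theta) (p : Theta -> ZB -> R) (F : ZB -> R).
Hypothesis dq : is_density mu q.
Hypothesis q0 : forall z, 0 < q z.
Hypothesis iid : iid_law mu q P.
Hypothesis nested : forall K, ThetaK K `<=` ThetaK K.+1.
Hypothesis dp : forall K th, ThetaK K th -> is_density mu (p th).
Hypothesis pF : forall K th z, ThetaK K th -> `|llr q (p th) z| <= F z.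
Hypothesis F0 : forall z, 0 <= F z.
Hypothesis LF : L1_dens mu q F.
Hypothesis phiF : L1_dens mu q (fun z => phiLL (F z)).
Hypothesis cK : forall K, (1 <= K)%N -> compact (ThetaK K).
Hypothesis cp : forall K z, (1 <= K)%N ->
  {within ThetaK K, continuous (fun th => ln (p th z))}.
Variable KD : nat.
Hypothesis FD : donsker mu [set (fun z => ln (p th z) - ln (q z)) | th in ThetaK KD] q P.

Local Notation E th := (Edens mu q (llr q (p th))).

Lemma nested_le k K : (k <= K)%N -> ThetaK k `<=` ThetaK K.
Proof.
by move=> /subnK <-; elim: (K - k)%N => // i IH th /IH; exact: nested.
Qed.

Lemma core_lil (x : nat -> Theta) : (forall k, ThetaK KD (x k)) -> exists2 C, 0 < C &
  {ae P, forall w : Seq Z, exists N, forall n, (N <= n)%N ->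
    (forall k b, (1 <= k <= KD)%N -> (forall th, ThetaK k th -> E th <= b) ->
       forall th, ThetaK k th -> \sum_(i < n) llr q (p th) (w i) <= n%:R * b + C * lil_rate n) /\
    (forall k, `|\sum_(i < n) llr q (p (x k)) (w i) - n%:R * E (x k)| <= C * lil_rate n)}.
Proof.
move=> xK.
have /choice [s hs] k : exists s : nat -> Theta, (1 <= k <= KD)%N -> ThetaK k !=set0 ->
    (forall i, ThetaK k (s i)) /\
    forall th U, ThetaK k th -> nbhs th U -> exists i, U (s i).
  have [[/andP[k1 kK] [a Aa]]|no] := pselect ((1 <= k <= KD)%N /\ ThetaK k !=set0).
    by have [s hs] := compact_dense_seq (cK k1) Aa; exists s.
  by exists x => h1 h2; exfalso; apply: no.
(* [t] enumerates the dense sequences [s k] together with the prescribed points [x k]. *)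
have /choice [t ht] m : exists th, ThetaK KD th /\
    forall (b : bool) k j, m = choice.pickle (b, k, j) ->
     ThetaK KD (if b then s k j else x k) -> th = if b then s k j else x k.
  pose a := if @choice.unpickle (bool * nat * nat)%type m is Some (b, k, j)
            then if b then s k j else x k else x 0%N.
  have [Aa|nAa] := pselect (ThetaK KD a).
    by exists a; split => // b k j me _; rewrite /a me choice.pickleK.
  exists (x 0%N); split => // b k j me; rewrite /= => Ka; exfalso; apply: nAa.
  by rewrite /a me choice.pickleK.
have [C C0 aeC] := seq_lil dq q0 iid (@dp KD) (fun th z => @pF KD th z) F0 LF phiF FD
  (fun m => (ht m).1).
exists C => //; apply: filterS aeC => w [N hN]; exists N => n Nn; split; last first.
  move=> k; have := hN n (choice.pickle (false, k, 0%N)) Nn.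
  by rewrite ((ht _).2 false k 0%N erefl) //=; exact: xK.
move=> k b /[dup] k1K /andP[k1 kK] hb th Ath.
have [sk1 sk2] := hs k k1K (ex_intro _ th Ath).
have hsj j : \sum_(i < n) llr q (p (s k j)) (w i) <= n%:R * b + C * lil_rate n.
  have := hN n (choice.pickle (true, k, j)) Nn.
  rewrite ((ht _).2 true k j erefl) /=; last by apply: nested_le kK _ _.
  move=> h; have := le_trans (ler_norm _) h; have := hb _ (sk1 j).
  by move=> /(ler_wpM2l (ler0n R n)); lra.
have cS : {within ThetaK k, continuous (fun th => \sum_(i < n) llr q (p th) (w i))}.
  apply/subspace_continuousP => a Aa; apply: cvg_big => [|i _]; first exact: add_continuous.
  by apply: cvgB; [have /subspace_continuousP := @cp k (w i) k1; exact|exact: cvg_cst].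
rewrite leNgt; apply/negP => hgt.
have /subspace_continuousP/(_ th Ath) := cS.
move=> /(cvgr_gt (\sum_(i < n) llr q (p th) (w i))) /(_ _ hgt) /= hU.
have [j /(_ (sk1 j))] := sk2 th _ Ath hU.
by rewrite /= ltNge hsj.
Qed.

End Core.

(** * Order selection *)

Lemma limn_esup_lt_near (R : realType) (v : nat -> \bar R) (a : \bar R) :
  (limn_esup v < a)%E -> exists s N, (s < a)%E /\ forall n, (N <= n)%N -> (v n <= s)%E.
Proof.
move=> /ereal_inf_lt [_ [V [N _ NV] <-] h].
exists (ereal_sup (v @` V)), N; split => // n Nn.
by apply: ereal_sup_ubound; exists n => //; exact: NV.
Qed.

Lemma uniform_eventually (M : nat) (Q : nat -> nat -> Prop) :
  (forall k, (k < M)%N -> exists N, forall n, (N <= n)%N -> Q k n) ->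
  exists N, forall n, (N <= n)%N -> forall k, (k < M)%N -> Q k n.
Proof.
elim: M => [|M IH] h; first by exists 0%N.
have [N1 h1] := IH (fun k kM => h k (ltnW kM)).
have [N2 h2] := h M (ltnSn M).
exists (maxn N1 N2) => n; rewrite geq_max => /andP[n1 n2] k.
by rewrite ltnS leq_eqVlt => /predU1P[->|kM]; [exact: h2|exact: h1].
Qed.

Section Crit.
Context {R : realType} {Z Theta : Type}.
Variables (ThetaK : nat -> set Theta) (p : Theta -> Z -> R) (pen : nat -> nat -> R).

Lemma crit_le (w : nat -> Z) n k (b : R) :
  (forall th, ThetaK k th -> \sum_(i < n) ln (p th (w i)) <= b) ->
  (crit ThetaK p pen w n k <= (b - pen n k)%:E)%E.
Proof.
move=> h; rewrite /crit EFinB leeB //; apply: ge_ereal_sup => _ [th /h hb <-].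
by rewrite lee_fin.
Qed.

Lemma crit_ge (w : nat -> Z) n k th : ThetaK k th ->
  ((\sum_(i < n) ln (p th (w i)) - pen n k)%:E <= crit ThetaK p pen w n k)%E.
Proof.
by move=> h; rewrite /crit EFinB leeB //; apply: ereal_sup_ubound; exists th.
Qed.

End Crit.

Section Penalty.
Context {R : realType}.
Variable pen : nat -> nat -> R.
Hypothesis pen0 : forall n K, (1 <= K)%N -> 0 < pen n K.

Lemma pen_ge_rate K (c : R) : (1 <= K)%N -> 0 < c ->
  limn_esup (fun n => (Num.sqrt (n%:R * ln (ln n%:R)) / pen n K)%:E) = 0%E ->
  exists N, forall n, (N <= n)%N -> c * lil_rate n <= pen n K.
Proof.
move=> K1 c0 h.
have : (limn_esup (fun n => (Num.sqrt (n%:R * ln (ln n%:R)) / pen n K)%:E) < (c^-1)%:E)%E.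
  by rewrite h lte_fin invr_gt0.
move=> /limn_esup_lt_near [s [N [sc hN]]]; exists N => n /hN h1.
have := le_lt_trans h1 sc; rewrite lte_fin -/(lil_rate n).
by rewrite ltr_pdivrMr ?pen0 // mulrC ltr_pdivlMr // mulrC => /ltW.
Qed.

Lemma pen_le_linear K (e : R) : (1 <= K)%N -> 0 < e ->
  (fun n => pen n K / n%:R) @ \oo --> 0 ->
  exists N, forall n, (N <= n)%N -> pen n K <= e * n%:R.
Proof.
move=> K1 e0 /cvgr0Pnorm_le /(_ e e0) [N _ hN]; exists N.+1 => n Nn.
have n0 : 0 < n%:R :> R by rewrite ltr0n (leq_ltn_trans _ Nn).
have := hN n (ltnW Nn); rewrite /= ger0_norm; last by rewrite divr_ge0 // ltW // pen0.
by rewrite ler_pdivrMr.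
Qed.

Lemma pen_jump K : (1 <= K)%N ->
  (1 < limn_einf (fun n => (pen n K.+1 / pen n K)%:E))%E ->
  exists2 delta, 0 < delta & exists N, forall n, (N <= n)%N ->
    (1 + delta) * pen n K <= pen n K.+1.
Proof.
move=> K1; rewrite /limn_einf lteNr => /limn_esup_lt_near [s [N [s1 hN]]].
have [d d0 sd] : exists2 d : R, 0 < d & (s <= (- (1 + d))%:E)%E.
  case: s s1 {hN} => [r| |] //=.
    rewrite lte_fin => r1; exists (- 1 - r); first by lra.
    by rewrite lee_fin; lra.
  by move=> _; exists 1 => //; rewrite leNye.
exists d => //; exists N => n /hN h; have := le_trans h sd.
by rewrite -EFinN lee_fin lerN2 ler_pdivlMr ?pen0.
Qed.

End Penalty.

Section Selection.
Context {R : realType} {Z : ptopologicalType} {Theta : metricType R}.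
Local Notation ZB := (Borel Z).
Variables (mu : {measure set ZB -> \bar R}) (q : ZB -> R).
Variables (ThetaK : nat -> set Theta) (p : Theta -> ZB -> R) (pen : nat -> nat -> R).
Hypothesis pen0 : forall n K, (1 <= K)%N -> 0 < pen n K.
Hypothesis penS : forall n K, (1 <= K)%N -> pen n K <= pen n K.+1.
Hypothesis penlin : forall K, (1 <= K)%N -> (fun n => pen n K / n%:R) @ \oo --> 0.
Hypothesis penrate : forall K, (1 <= K)%N ->
  limn_esup (fun n => (Num.sqrt (n%:R * ln (ln n%:R)) / pen n K)%:E) = 0%E.
Hypothesis penjump : forall K, (1 <= K)%N ->
  (1 < limn_einf (fun n => (pen n K.+1 / pen n K)%:E))%E.

Local Notation E th := (Edens mu q (llr q (p th))).

Lemma pen_mono n K k : (1 <= K)%N -> (K <= k)%N -> pen n K <= pen n k.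
Proof.
move=> K1 /subnK <-; elim: (k - K)%N => // i IH; apply: (le_trans IH).
by rewrite addSn; apply: penS; rewrite (leq_trans K1) ?leq_addl.
Qed.

Lemma sum_ln_llr (w : nat -> Z) n th :
  \sum_(i < n) ln (p th (w i)) =
  \sum_(i < n) ln (q (w i)) + \sum_(i < n) llr q (p th) (w i).
Proof. by rewrite -big_split; apply: eq_bigr => i _ /=; rewrite /llr addrCA subrr addr0. Qed.

Section OnePath.
Variables (w : nat -> Z) (C : R) (KD N0 : nat).
Hypothesis C0 : 0 < C.
Hypothesis upper : forall n, (N0 <= n)%N -> forall k b, (1 <= k <= KD)%N ->
  (forall th, ThetaK k th -> E th <= b) ->
  forall th, ThetaK k th -> \sum_(i < n) llr q (p th) (w i) <= n%:R * b + C * lil_rate n.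

Lemma crit_overfit (K k N1 : nat) th : (1 <= K)%N -> (K < k <= KD)%N ->
  ThetaK K th -> E th = 0 -> (forall th, ThetaK k th -> E th <= 0) ->
  (forall n, (N1 <= n)%N ->
     `|\sum_(i < n) llr q (p th) (w i) - n%:R * E th| <= C * lil_rate n) ->
  exists N, forall n, (N <= n)%N ->
    (crit ThetaK p pen w n k <= crit ThetaK p pen w n K)%E.
Proof.
move=> K1 /andP[Kk kKD] Kth Eth Ek lower.
have [d d0 [N2 h2]] := pen_jump pen0 K1 (penjump K1).
have [|N3 h3] := pen_ge_rate pen0 (c := 2 * C / d) K1 _ (penrate K1).
  by rewrite divr_gt0 // mulr_gt0.
exists (maxn (maxn N0 N1) (maxn N2 N3)) => n.
rewrite !geq_max -!andbA => /and4P[n0 n1 n2 n3].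
have k1 : (1 <= k <= KD)%N by rewrite kKD (leq_trans K1) // ltnW.
set S := \sum_(i < n) ln (q (w i)).
have up := upper n0 k1 Ek.
apply: (@le_trans _ _ (S + C * lil_rate n - pen n k)%:E).
  apply: crit_le => t /up; rewrite mulr0 add0r sum_ln_llr -/S => h; by rewrite lerD2l.
apply: le_trans (crit_ge _ _ _ _ Kth); rewrite lee_fin sum_ln_llr -/S.
have := lower n n1; rewrite Eth mulr0 subr0 ler_norml => /andP[low _].
have := h3 n n3; rewrite mulrAC ler_pdivrMr // => h3n.
have := h2 n n2; have := pen_mono n (K := K.+1) (k := k) isT Kk; lra.
Qed.

Lemma crit_underfit (k m N1 : nat) (b : R) th : (1 <= k <= KD)%N -> (1 <= m)%N ->
  ThetaK m th -> (forall th, ThetaK k th -> E th <= b) -> b < E th ->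
  (forall n, (N1 <= n)%N ->
     `|\sum_(i < n) llr q (p th) (w i) - n%:R * E th| <= C * lil_rate n) ->
  exists N, forall n, (N <= n)%N ->
    (crit ThetaK p pen w n k < crit ThetaK p pen w n m)%E.
Proof.
move=> k1 m1 mth Ek bE lower.
have [|N2 h2] := pen_ge_rate pen0 (c := 2 * C) m1 _ (penrate m1); first by rewrite mulr_gt0.
have [|N3 h3] := pen_le_linear pen0 (e := (E th - b) / 4) m1 _ (penlin m1).
  by rewrite divr_gt0 // subr_gt0.
exists (maxn (maxn N0 N1) (maxn N2 (maxn N3 1))) => n.
rewrite !geq_max -!andbA => /and5P[n0 n1 n2 n3 npos].
have nR : 0 < n%:R :> R by rewrite ltr0n.
set S := \sum_(i < n) ln (q (w i)).
have up := upper n0 k1 Ek.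
apply: (@le_lt_trans _ _ (S + (n%:R * b + C * lil_rate n) - pen n k)%:E).
  by apply: crit_le => t /up h; rewrite sum_ln_llr -/S lerD2l.
apply: lt_le_trans (crit_ge _ _ _ _ mth); rewrite lte_fin sum_ln_llr -/S.
have := lower n n1; rewrite ler_norml => /andP[low _].
have := h2 n n2; have := h3 n n3; have /andP[k1' _] := k1; have := pen0 n k1'.
have : 0 < (E th - b) * n%:R by rewrite mulr_gt0 // subr_gt0.
by move: low; rewrite mulrBl [n%:R * _]mulrC [n%:R * _]mulrC; lra.
Qed.

End OnePath.

End Selection.

Unset Implicit Arguments. Set Strict Implicit. Set Printing Implicit Defensive.

Theorem theorem3
  (R : realType) (Z : ptopologicalType)
  (mu : {measure set (Borel Z) -> \bar R})
  (Theta : metricType R) (ThetaK : nat -> set Theta)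
  (p : Theta -> Borel Z -> R) (pstar : Borel Z -> R)
  (P : probability (Seq Z) R)
  (l u : Borel Z -> R) (pen : nat -> nat -> R) (Kstar : nat) :
  (* setting *)
  polish R Z ->
  sigma_finite setT mu ->
  is_density mu pstar ->
  iid_law mu pstar P ->
  ThetaK 0 = set0 ->
  (forall K, ThetaK K `<=` ThetaK K.+1) ->
  (forall K th, ThetaK K th -> is_density mu (p th)) ->
  (* (A1) *)
  (forall K, (1 <= K)%N -> compact (ThetaK K)) ->
  (forall K, (1 <= K)%N -> weak_compact mu (p @` ThetaK K)) ->
  (* (A2) *)
  (forall K z, (1 <= K)%N -> {within ThetaK K, continuous (fun th => ln (p th z))}) ->
  (* (A3) *)
  L1_dens mu pstar (fun z => u z - l z) ->
  (forall z, 0 < pstar z /\ l z <= ln (pstar z) <= u z) ->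
  (forall K th z, ThetaK K th -> 0 < p th z /\ l z <= ln (p th z) <= u z) ->
  (* (A4) *)
  (forall n K, (1 <= K)%N -> 0 < pen n K) ->
  (forall n K, (1 <= K)%N -> pen n K <= pen n K.+1) ->
  (forall K, (1 <= K)%N -> (fun n => pen n K) @ \oo --> +oo) ->
  (forall K, (1 <= K)%N -> (fun n => pen n K / n%:R) @ \oo --> 0) ->
  (* P* in Pi_{K*} \ Pi_{K*-1}, K* finite *)
  (exists2 th, ThetaK Kstar th & same_law mu pstar (p th)) ->
  ~ (exists2 th, ThetaK Kstar.-1 th & same_law mu pstar (p th)) ->
  (* integrability of phi(u - l) *)
  L1_dens mu pstar (fun z => phiLL (u z - l z)) ->
  (* penalty conditions *)
  (forall K, (1 <= K)%N ->
     (1 < limn_einf (fun n => (pen n K.+1 / pen n K)%:E))%E) ->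
  (forall K, (1 <= K)%N ->
     limn_esup (fun n => (Num.sqrt (n%:R * ln (ln n%:R)) / pen n K)%:E) = 0%E) ->
  (* (a) *)
  ((forall K, (1 <= K)%N ->
      ~ (exists2 th, ThetaK K th & same_law mu pstar (p th)) ->
      (KLset mu pstar (p @` ThetaK K.+1) < KLset mu pstar (p @` ThetaK K))%E) ->
   donsker mu [set (fun z => ln (p th z) - ln (pstar z)) | th in ThetaK Kstar.+1]
           pstar P ->
   {ae P, forall w, exists N, forall n, (N <= n)%N ->
        is_KhatL (crit ThetaK p pen w n) Kstar})
  /\
  (* (b) *)
  (forall Kmax : nat, (Kstar <= Kmax)%N ->
   donsker mu [set (fun z => ln (p th z) - ln (pstar z)) | th in ThetaK Kmax]
           pstar P ->
   {ae P, forall w, exists N, forall n, (N <= n)%N ->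
        is_KhatG (crit ThetaK p pen w n) Kmax Kstar}).
Proof.
move=> _ _ dq iid T0 nested dp cK _ cp LF qlu plu pen0 penS _ penlin [ths Ths sls] nosl
  phiF penjump penrate.
pose F z := u z - l z.
have q0 z : 0 < pstar z by have [] := qlu z.
have p0 K th z : ThetaK K th -> 0 < p th z by move=> h; have [] := plu K th z h.
have pF K th z : ThetaK K th -> `|llr pstar (p th) z| <= F z.
  move=> h; have [_ /andP[h1 h2]] := plu K th z h; have [_ /andP[h3 h4]] := qlu z.
  by rewrite /llr /F ler_norml; apply/andP; split; lra.
have F0 z : 0 <= F z.
  by have [_ /andP[h3 h4]] := qlu z; rewrite /F; lra.
pose E th := Edens mu pstar (llr pstar (p th)).
have Ks1 : (1 <= Kstar)%N.
  by rewrite lt0n; apply/eqP => K0; move: Ths; rewrite K0 T0.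
have up k K : (k <= K)%N -> ThetaK k `<=` ThetaK K by move=> h; exact: nested_le h.
have E0 K th : ThetaK K th -> E th <= 0.
  move=> Kth; apply: (gibbs dq q0 LF) => [|z|z]; first exact: dp Kth.
    exact: p0 Kth.
  exact: pF Kth.
have Es : E ths = 0.
  rewrite /E; apply: (same_law_Edens dq LF) => //; first exact: dp Ths.
  by move=> z; exact: pF Ths.
have nosl' k th : (k < Kstar)%N -> ThetaK k th -> ~ same_law mu pstar (p th).
  move=> kK kth sl; apply: nosl; exists th => //; apply: up kth.
  by rewrite -ltnS prednK.
split.
- move=> KLlt FD.
  have /choice [x hx] k : exists th, ThetaK Kstar.+1 th /\ if k == 0%N then th = ths else
      (k < Kstar)%N -> ThetaK k.+1 th /\
        exists2 b, (forall t, ThetaK k t -> E t <= b) & b < E th.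
    case: k => [|k]; first by exists ths; split => //; apply: nested.
    have [kK|Kk] := ltnP k.+1 Kstar; last first.
      by exists ths; split => //=; exact: nested.
    have /ereal_inf_lt [_ [_ [th kth <-] <-] KLth] :=
      KLlt k.+1 isT (fun h => let: ex_intro2 t a b := h in nosl' k.+1 t kK a b).
    exists th; split; first by apply: up kth; rewrite ltnW.
    move=> /= _; split => //.
    have KLE K t : ThetaK K t -> KL mu pstar (p t) = (- E t)%:E.
      move=> Kt; apply: (KL_llr dq q0 LF) => [|z|z]; first exact: dp Kt.
        exact: p0 Kt.
      exact: pF Kt.
    rewrite (KLE _ _ kth) in KLth.
    have le_inf t : ThetaK k.+1 t -> (KLset mu pstar (p @` ThetaK k.+1) <= (- E t)%:E)%E.
      by move=> kt; rewrite -(KLE _ _ kt); apply: ereal_inf_lbound; exists (p t) => //; exists t.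
    case: (KLset _ _ _) KLth le_inf => [r| |] // h le_inf.
      exists (- r); last by move: h; rewrite lte_fin; lra.
      by move=> t /le_inf; rewrite lee_fin; lra.
    exists (E th - 1); last by lra.
    by move=> t /le_inf; rewrite leye_eq.
  have [C C0 aeC] := core_lil dq q0 iid nested dp pF F0 LF phiF cK cp FD (fun k => (hx k).1).
  apply: filterS aeC => w [N0 hN].
  have upper n (h : (N0 <= n)%N) := (hN n h).1.
  have lower k n (h : (N0 <= n)%N) := (hN n h).2 k.
  have x0 : x 0%N = ths := (hx 0%N).2.
  have [N1 h1] : exists N, forall n, (N <= n)%N ->
      (crit ThetaK p pen w n Kstar.+1 <= crit ThetaK p pen w n Kstar)%E.
    apply: (crit_overfit pen0 penS penrate penjump C0 upper Ks1 _ Ths Es).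
    - by rewrite ltnS !leqnn.
    - by move=> t; exact: E0.
    - by move=> n /(lower 0%N); rewrite x0; exact.
  have [N2 h2] : exists N, forall n, (N <= n)%N -> forall k, (k < Kstar)%N -> (1 <= k)%N ->
      (crit ThetaK p pen w n k < crit ThetaK p pen w n k.+1)%E.
    apply: uniform_eventually => -[_|k kK]; first by exists 0%N.
    have [/= _ /(_ kK) [kx [b hb bE]]] := hx k.+1.
    have k1 : (1 <= k.+1 <= Kstar.+1)%N by rewrite /= ltnW // ltnW.
    have [N h] := crit_underfit (m := k.+2) pen0 penlin penrate C0 upper k1 isT kx hb bE (lower k.+1).
    by exists N => n /h.
  exists (maxn N1 N2) => n; rewrite geq_max => /andP[n1 n2]; split => //; first exact: h1.
  by move=> k /andP[k1 kK]; exact: h2.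
- move=> Kmax KsKm FD.
  have Kmths (k : nat) : ThetaK Kmax ((fun _ : nat => ths) k) by exact: up KsKm _ Ths.
  have [C C0 aeC] := core_lil dq q0 iid nested dp pF F0 LF phiF cK cp FD (x := fun=> ths) Kmths.
  apply: filterS aeC => w [N0 hN].
  have upper n (h : (N0 <= n)%N) := (hN n h).1.
  have lower n (h : (N0 <= n)%N) := (hN n h).2 0%N.
  have [N1 h1] : exists N, forall n, (N <= n)%N -> forall k, (k < Kmax.+1)%N -> (Kstar < k)%N ->
      (crit ThetaK p pen w n k <= crit ThetaK p pen w n Kstar)%E.
    apply: uniform_eventually => k kK; have [kKs|Ksk] := leqP k Kstar.
      by exists 0%N.
    have [||N h] := crit_overfit pen0 penS penrate penjump C0 upper (k := k) Ks1 _ Ths Es _ lower.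
    - by rewrite Ksk.
    - by move=> t; exact: E0.
    by exists N => n /h.
  have [N2 h2] : exists N, forall n, (N <= n)%N -> forall k, (k < Kstar)%N -> (1 <= k)%N ->
      (crit ThetaK p pen w n k < crit ThetaK p pen w n Kstar)%E.
    apply: uniform_eventually => k kKs.
    have [k0|k1] := leqP k 0; first by exists 0%N.
    have [delta d0 hd] := Edens_llr_gap dq q0 LF (cK k k1) (@dp k) (fun th z => p0 k th z)
      (fun th z => pF k th z) (fun z => cp k z k1) (fun th => nosl' k th kKs).
    have k1' : (1 <= k <= Kmax)%N by rewrite k1 (leq_trans (ltnW kKs)).
    have [|N h] := crit_underfit pen0 penlin penrate C0 upper k1' Ks1 Ths hd _ lower.
      by rewrite -/(E ths) Es oppr_lt0.
    by exists N => n /h.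
  exists (maxn N1 N2) => n; rewrite geq_max => /andP[n1 n2]; split.
  + by rewrite Ks1.
  + move=> k /andP[k1 kK]; case: (ltngtP k Kstar) => [kKs|Ksk|->] //.
      by apply/ltW/h2.
    exact: h1.
  + by move=> k /andP[k1 kK]; exact: h2.
Qed.
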